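(* There exists a transcendental entire function $f$ such that each of the sets $\widehat{I}(f) := I(f)\cup\{\infty\}$, $\widehat{BO}(f) := BO(f)\cup\{\infty\}$ and $\widehat{BU}(f) := BU(f)\cup\{\infty\}$ is a connected subset of the Riemann sphere $\widehat{\mathbb{C}}$.
   Context: For an entire function $f$, $f^n$ denotes its $n$-th iterate. The escaping set is $I(f) := \{z\in\mathbb{C} : f^n(z)\to\infty \text{ as } n\to\infty\}$. The bounded orbit set is $BO(f) := \{z\in\mathbb{C} : \text{there exists } K>0 \text{ such that } |f^n(z)|<K \text{ for all } n\ge 0\}$. The bungee set is $BU(f) := \mathbb{C}\setminus (I(f)\cup BO(f))$. *)

(* Defs.v *)
From HB Require Import structures.
From mathcomp Require Import all_boot all_order all_algebra.
From mathcomp Require Import complex.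
From mathcomp Require Import all_classical all_reals all_analysis.
Import Order.TTheory GRing.Theory Num.Theory ComplexField.
Import numFieldTopology.Exports numFieldNormedType.Exports.
Set Implicit Arguments. Unset Strict Implicit. Unset Printing Implicit Defensive.
Local Open Scope ring_scope.
Local Open Scope classical_set_scope.

HB.instance Definition _ (R : rcfType) :=
  PseudoPointedMetric.copy R[i] (R[i] : numClosedFieldType)^o.
HB.instance Definition _ (R : rcfType) :=
  NormedModule.copy R[i] (R[i] : numClosedFieldType)^o.

(* The Riemann sphere: one-point compactification of C; None is infinity. *)
Definition riemann_sphere (R : realType) := one_point_compactification R[i].

Definition entire (R : realType) (f : R[i] -> R[i]) : Prop :=
  forall z : R[i], derivable f z 1.

Definition transcendental (R : realType) (f : R[i] -> R[i]) : Prop :=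
  ~ exists p : {poly R[i]}, forall z, f z = p.[z].

Definition escaping_set (R : realType) (f : R[i] -> R[i]) : set R[i] :=
  [set z | forall M : R, exists N : nat, forall n : nat, (N <= n)%N ->
      (M%:C)%C < `|iter n f z|].

Definition bounded_orbit_set (R : realType) (f : R[i] -> R[i]) : set R[i] :=
  [set z | exists K : R, 0 < K /\ forall n : nat, `|iter n f z| < (K%:C)%C].

Definition bungee_set (R : realType) (f : R[i] -> R[i]) : set R[i] :=
  ~` (escaping_set f `|` bounded_orbit_set f).

Definition add_infty (R : realType) (A : set R[i]) : set (riemann_sphere R) :=
  (Some @` A) `|` [set None].

(* Main.v *)
Require Import Defs.
From HB Require Import structures.
From mathcomp Require Import all_boot all_order all_algebra.
From mathcomp Require Import complex.
From mathcomp Require Import all_classical all_reals all_analysis.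
From mathcomp Require Import ring lra.
Import Order.TTheory GRing.Theory Num.Theory ComplexField.
Import numFieldTopology.Exports numFieldNormedType.Exports.
Set Implicit Arguments. Unset Strict Implicit. Unset Printing Implicit Defensive.
Local Open Scope ring_scope.
Local Open Scope classical_set_scope.

(** The function is [f z = z e^(z+1)], which lifts through [exp] to
    [F w = w + 1 + e^w]. It has the superattracting fixed point [-1], whose
    basin contains the unit disc [D] about [-1]; moreover the positive axis
    escapes and the negative axis has bounded orbits.

    If the union of [infty] and a backward invariant set [A] is disconnected,
    then some bounded open [U] meets [A] while its boundary does not. The images
    of [U] inherit this property (off the critical point [-1]), so that none of
    them can meet an unbounded curve in [A]. Outside [D] the map [F] expands, so
    small discs blow up in the logarithmic coordinate: if [U] contains a point
    with unbounded orbit, then some image of [U] meets the positive axis, and in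
    any case some image meets [D] or the negative axis. This gives the claim for
    the escaping set and for the set of bounded orbits. For the bungee set, close
    to any segment of the positive axis there is a curve of points which all
    shadow the same itinerary: they move along the positive axis, cross to the
    negative axis when far out, and are thus thrown back near [0], again and
    again. *)

Notation nm := Normc.normc.
Notation Re := complex.Re.
Notation Im := complex.Im.

(** * Modulus, real and imaginary parts *)

Section Modulus.
Context {R : realType}.
Implicit Types (z w : R[i]) (x y : R).

Lemma normE z : `|z| = (nm z)%:C%C. Proof. by []. Qed.

Lemma nm_ge0 z : 0 <= nm z.
Proof. by case: z => a b; rewrite /nm sqrtr_ge0. Qed.

Lemma nmD z w : nm (z + w) <= nm z + nm w.
Proof. exact: le_normcD. Qed.

Lemma nmN z : nm (- z) = nm z.
Proof. exact: normcN. Qed.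

Lemma nmM z w : nm (z * w) = nm z * nm w.
Proof. exact: Normc.normcM. Qed.

Lemma nmB_sym z w : nm (z - w) = nm (w - z).
Proof. by rewrite -nmN opprB. Qed.

Lemma nm_le_dist z w v : nm (z - w) <= nm (z - v) + nm (v - w).
Proof. by rewrite (_ : z - w = (z - v) + (v - w)) ?nmD //; ring. Qed.

Lemma nmB_le z w : nm (z - w) <= nm z + nm w.
Proof. by rewrite -(nmN w) nmD. Qed.

Lemma nm_geB z w : nm z - nm w <= nm (z + w).
Proof.
by rewrite lerBlDr -(nmN w) (le_trans _ (nmD _ _)) // addrK.
Qed.

Lemma nm_le_add z w x : nm (z - w) <= x -> nm z <= x + nm w.
Proof. by move=> H; rewrite -(subrK w z) (le_trans (nmD _ _)) // lerD2r. Qed.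

Lemma nm_real x : nm (x%:C)%C = `|x|.
Proof. by rewrite /nm /= expr0n addr0 sqrtr_sqr. Qed.

Lemma nm0 : nm (0 : R[i]) = 0. Proof. exact: Normc.normc0. Qed.
Lemma nm1 : nm (1 : R[i]) = 1. Proof. exact: Normc.normc1. Qed.

Lemma nm_eq0 z : (nm z == 0) = (z == 0).
Proof. by apply/eqP/eqP => [/Normc.eq0_normc|->]; rewrite ?nm0. Qed.

Lemma nm_gt0 z : (0 < nm z) = (z != 0).
Proof. by rewrite lt_def nm_eq0 nm_ge0 andbT. Qed.

Lemma nm_sq z : nm z ^+ 2 = Re z ^+ 2 + Im z ^+ 2.
Proof. by case: z => a b; rewrite sqr_sqrtr ?addr_ge0 ?sqr_ge0. Qed.

Lemma ReD z w : Re (z + w) = Re z + Re w. Proof. by case: z; case: w. Qed.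
Lemma ImD z w : Im (z + w) = Im z + Im w. Proof. by case: z; case: w. Qed.
Lemma ReN z : Re (- z) = - Re z. Proof. by case: z. Qed.
Lemma ImN z : Im (- z) = - Im z. Proof. by case: z. Qed.
Lemma ReM z w : Re (z * w) = Re z * Re w - Im z * Im w.
Proof. by case: z; case: w. Qed.
Lemma ImM z w : Im (z * w) = Re z * Im w + Im z * Re w.
Proof. by case: z => ? ?; case: w. Qed.

Definition ReImE := (ReD, ImD, ReN, ImN, ReM, ImM).

Lemma ReIm_eq z w : Re z = Re w -> Im z = Im w -> z = w.
Proof. by case: z => ? ?; case: w => ? ? /= -> ->. Qed.

Lemma Re_le_nm z : `|Re z| <= nm z.
Proof.
rewrite -(@ler_pXn2r _ 2) ?nnegrE ?nm_ge0 // real_normK ?num_real //.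
by rewrite nm_sq lerDl sqr_ge0.
Qed.

Lemma Im_le_nm z : `|Im z| <= nm z.
Proof.
rewrite -(@ler_pXn2r _ 2) ?nnegrE ?nm_ge0 // real_normK ?num_real //.
by rewrite nm_sq lerDr sqr_ge0.
Qed.

Lemma nm_le_ReIm z : nm z <= `|Re z| + `|Im z|.
Proof.
have -> : z = ((Re z)%:C + (Im z)%:C * 'i)%C.
  by apply: ReIm_eq; rewrite !ReImE /=; ring.
rewrite (le_trans (nmD _ _)) // nmM !nm_real.
have -> : nm ('i%C : R[i]) = 1 by rewrite /nm /= expr0n add0r expr1n sqrtr1.
by rewrite mulr1 !ReImE /= !(mulr0, mul0r, mulr1, subr0, addr0, add0r).
Qed.

Lemma nm_conj z : nm (z^*)%C = nm z.
Proof. by case: z => a b; rewrite /nm /= sqrrN. Qed.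

(** For nonzero [z], [c] is the conjugate of [z] over its modulus. Bounds on a modulus thus reduce
    to bounds on real parts, where real calculus applies. *)
Lemma nm_dual z : exists2 c : R[i], nm c = 1 & Re (c * z) = nm z.
Proof.
have [->|z0] := eqVneq z 0; first by exists 1; rewrite ?nm1 // mul1r nm0.
have nz : nm z != 0 by rewrite nm_eq0.
exists ((nm z)^-1%:C * z^*)%C.
  rewrite nmM nm_real nm_conj ger0_norm ?mulVf // invr_ge0 nm_ge0 //.
have -> : Re ((nm z)^-1%:C * z^* * z)%C = (nm z)^-1 * (nm z ^+ 2).
  by rewrite nm_sq !ReImE; case: (z) => a b /=; ring.
by rewrite expr2 mulKf.
Qed.

End Modulus.

(** * Real differentiation rules in pointwise form *)

Section PointwiseDerivatives.
Context {R : realType}.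
Implicit Types (f g : R -> R) (x a b : R).

Lemma der_cst x a : is_derive x 1 (fun=> a) 0.
Proof. exact: is_derive_cst. Qed.

Lemma der_id x : is_derive x 1 (fun t : R => t) 1.
Proof. exact: is_derive_id. Qed.

Lemma derD f g x a b : is_derive x 1 f a -> is_derive x 1 g b ->
  is_derive x 1 (fun t => f t + g t) (a + b).
Proof.
move=> fa gb; have -> : (fun t => f t + g t) = f + g by apply/funext.
exact: is_deriveD.
Qed.

Lemma derN f x a : is_derive x 1 f a -> is_derive x 1 (fun t => - f t) (- a).
Proof.
move=> fa; have -> : (fun t => - f t) = - f by apply/funext.
exact: is_deriveN.
Qed.

Lemma derM f g x a b : is_derive x 1 f a -> is_derive x 1 g b ->
  is_derive x 1 (fun t => f t * g t) (f x * b + g x * a).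
Proof.
move=> fa gb; have -> : (fun t => f t * g t) = f * g by apply/funext.
exact: is_deriveM.
Qed.

Lemma der_exp f x a : is_derive x 1 f a ->
  is_derive x 1 (fun t => expR (f t)) (expR (f x) * a).
Proof. by move=> fa; apply: (@is_derive1_comp R expR). Qed.

Lemma der_cos f x a : is_derive x 1 f a ->
  is_derive x 1 (fun t => cos (f t)) (- sin (f x) * a).
Proof. by move=> fa; apply: (@is_derive1_comp R cos). Qed.

Lemma der_sin f x a : is_derive x 1 f a ->
  is_derive x 1 (fun t => sin (f t)) (cos (f x) * a).
Proof. by move=> fa; apply: (@is_derive1_comp R sin). Qed.

Lemma der_eq f x a b : is_derive x 1 f a -> a = b -> is_derive x 1 f b.
Proof. by move=> fa <-. Qed.

End PointwiseDerivatives.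

Ltac der := eapply der_eq;
  [repeat (first [eapply der_cst | eapply der_id
    | eapply derD | eapply derN | eapply derM
    | eapply der_exp | eapply der_cos | eapply der_sin
    | eassumption ]) | ].

(** * A mean value inequality for complex-valued curves *)

Section VectorMVT.
Context {R : realType}.

Lemma MVT_le (f df : R -> R) :
  (forall s : R, is_derive s 1 f (df s)) ->
  (forall s : R, 0 <= s <= 1 -> 0 <= df s) -> f 0 <= f 1.
Proof.
move=> fd df0.
have [|c] := @MVT_segment R f df 0 1 ler01 (fun x _ => fd x).
  by apply: derivable_within_continuous => x _; apply: ex_derive.
rewrite in_itv /= => c01 E; rewrite -subr_ge0 E subr0 mulr1; exact: df0.
Qed.

(** With the rotation [c] that makes [p 1 - p 0] a nonnegative real, [q - Re (c * p)] has
    nonnegative derivative on [0, 1]. Differentiability of [p] is expressed through its real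
    projections only. *)
Lemma vector_MVT (p p' : R -> R[i]) (q q' : R -> R) :
  (forall (c : R[i]) (s : R),
     is_derive s 1 (fun t => Re (c * p t)) (Re (c * p' s))) ->
  (forall s : R, is_derive s 1 q (q' s)) ->
  (forall s, 0 <= s <= 1 -> nm (p' s) <= q' s) ->
  nm (p 1 - p 0) <= q 1 - q 0.
Proof.
move=> pd qd le.
have [c c1 <-] := nm_dual (p 1 - p 0).
suff : q 0 - Re (c * p 0) <= q 1 - Re (c * p 1).
  rewrite mulrBr ReD ReN; lra.
have dd (s : R) :
    is_derive s 1 (fun t => q t - Re (c * p t)) (q' s - Re (c * p' s)).
  by have qds := qd s; have pds := pd c s; der.
apply: (MVT_le dd) => s s01; rewrite subr_ge0 (le_trans _ (le s s01)) //.
by rewrite (le_trans (ler_norm _)) // (le_trans (Re_le_nm _)) // nmM c1 mul1r.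
Qed.

End VectorMVT.

(** * The complex exponential and its logarithms *)

Section ComplexExponential.
Context {R : realType}.
Implicit Types (z w h : R[i]) (x y : R).

Definition cexp w : R[i] :=
  (expR (Re w) * cos (Im w) +i* (expR (Re w) * sin (Im w)))%C.

Lemma cexpD z w : cexp (z + w) = cexp z * cexp w.
Proof.
case: z => a b; case: w => c d; apply: ReIm_eq;
  rewrite !ReImE /= expRD ?cosD ?sinD; ring.
Qed.

Lemma cexp0 : cexp 0 = 1.
Proof. by rewrite /cexp /= expR0 cos0 sin0 !mul1r. Qed.

Lemma cexp_real x : cexp (x%:C)%C = (expR x)%:C%C.
Proof. by rewrite /cexp /= cos0 sin0 mulr1 mulr0. Qed.

Lemma nm_cexp w : nm (cexp w) = expR (Re w).
Proof.
by rewrite /nm /= !exprMn -mulrDr cos2Dsin2 mulr1 sqrtr_sqr ger0_norm.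
Qed.

Lemma cexp_neq0 w : cexp w != 0.
Proof. by rewrite -nm_gt0 nm_cexp expR_gt0. Qed.

(** The argument is the arc cosine of [Re z / nm z], with the sign of [Im z]. The bound [pi] later
    makes the exponential of a disc of radius above [pi] meet both real half-axes. *)
Lemma cexp_log z : z != 0 -> exists2 w, cexp w = z & `|Im w| <= pi.
Proof.
move=> z0; have nz : 0 < nm z by rewrite nm_gt0.
have nz' : nm z != 0 by rewrite gt_eqF.
set x := Re z / nm z.
have x1 : -1 <= x <= 1.
  rewrite -ler_norml normrM normfV (ger0_norm (nm_ge0 z)).
  by rewrite ler_pdivrMr // mul1r Re_le_nm.
have sx : nm z * Num.sqrt (1 - x ^+ 2) = `|Im z|.
  have -> : `|Im z| = Num.sqrt (nm z ^+ 2 * (1 - x ^+ 2)).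
    rewrite -sqrtr_sqr; congr Num.sqrt; rewrite mulrBr mulr1 /x exprMn exprVn.
    rewrite mulrCA divff ?sqrf_eq0 // mulr1 nm_sq; ring.
  by rewrite sqrtrM ?sqr_ge0 // sqrtr_sqr ger0_norm // ltW.
have cx : nm z * x = Re z by rewrite /x mulrC divfK.
have [I0|I0] := leP 0 (Im z).
  exists (ln (nm z) +i* acos x)%C; last first.
    by rewrite /= ger0_norm ?acos_ge0 ?acos_lepi.
  rewrite /cexp /= lnK ?posrE //.
  by rewrite acosK ?in_itv // sin_acos // sx cx ger0_norm //; case: (z).
exists (ln (nm z) -i* acos x)%C; last first.
  by rewrite /= normrN ger0_norm ?acos_ge0 ?acos_lepi.
rewrite /cexp /= lnK ?posrE //.
rewrite cosN sinN mulrN acosK ?in_itv // sin_acos // sx cx ltr0_norm // opprK.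
by case: (z).
Qed.

Lemma cexp_pi : cexp (pi *i)%C = -1.
Proof.
by apply: ReIm_eq; rewrite /= expR0 ?cospi ?sinpi ?mul1r // oppr0.
Qed.

Lemma is_derive_cexp_ray c w h (s : R) :
  is_derive s 1 (fun t => Re (c * cexp (w + t%:C%C * h)))
    (Re (c * (h * cexp (w + s%:C%C * h)))).
Proof.
case: c => c d; case: w => a b; case: h => u v.
have -> : (fun t => Re ((c +i* d) * cexp ((a +i* b) + t%:C * (u +i* v))))%C
   = (fun t => c * (expR (a + t * u) * cos (b + t * v))
               - d * (expR (a + t * u) * sin (b + t * v))).
  apply/funext => t; rewrite !ReImE /= !mul0r subr0 !addr0; ring.
rewrite !ReImE /= !mul0r subr0 !addr0.
der; rewrite /= ?mulr0 ?addr0 ?add0r ?mulr1; ring.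
Qed.

End ComplexExponential.

(** * Compactness and a quantitative open mapping theorem *)

Section Compactness.
Context {R : realType}.
Implicit Types (z w h : R[i]).

Lemma bolzano_weierstrass (u : nat -> R[i]) (M : R) :
  (forall n, nm (u n) <= M) ->
  exists z, forall e : R, 0 < e -> forall N, exists2 n, (N <= n)%N & nm (u n - z) < e.
Proof.
move=> uM.
pose K : set (R * R) := `[- M, M]%classic `*` `[- M, M]%classic.
have cK : compact K by apply: compact_setX; exact: segment_compact.
pose v n := (Re (u n), Im (u n)).
have FK : (v @ \oo) K.
  exists 0%N => // n _; split => /=; rewrite in_itv /= -ler_norml.
    exact: le_trans (Re_le_nm _) (uM n).
  exact: le_trans (Im_le_nm _) (uM n).
have [[a b] [_ clp]] := cK _ _ FK.
exists (a +i* b)%C => e e0 N.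
have e20 : 0 < e / 2 by rewrite divr_gt0.
have [||p [[n /= nN <-] [/= H1 H2]]] :=
    clp [set v n | n in [set n | (N <= n)%N]] (ball (a, b) (e / 2)).
- by exists N => // n /= nN; exists n.
- exact: nbhsx_ballx.
exists n => //; apply: le_lt_trans (nm_le_ReIm _) _.
rewrite !ReImE /= (splitr e) ltrD //.
  by rewrite distrC.
by rewrite distrC.
Qed.

Definition ccont (g : R[i] -> R[i]) z :=
  forall e : R, 0 < e -> exists2 d : R, 0 < d &
    forall y, nm (y - z) < d -> nm (g y - g z) < e.

Lemma ccont_comp g k z : ccont g z -> ccont k (g z) -> ccont (k \o g) z.
Proof.
move=> cg ck e /ck[d d0 H]; have [d' d'0 H'] := cg _ d0.
by exists d' => // y /H'/H.
Qed.

(** The complex derivative in remainder form, with real tolerances and no division by [h]. *)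
Definition cdiff (g : R[i] -> R[i]) z (d : R[i]) :=
  forall e : R, 0 < e -> exists2 r : R, 0 < r &
    forall h, nm h < r -> nm (g (z + h) - g z - d * h) <= e * nm h.

Lemma cdiff_ccont g z d : cdiff g z d -> ccont g z.
Proof.
move=> gd e e0; have [r r0 H] := gd 1 ltr01.
have k0 : 0 < 1 + nm d by rewrite ltr_pwDl // nm_ge0.
exists (Num.min r (e / (1 + nm d))).
  by rewrite lt_min r0 divr_gt0.
move=> y; rewrite lt_min => /andP[yr ye].
have := H _ yr; rewrite (_ : z + (y - z) = y); last by ring.
move=> H1; have -> : g y - g z = (g y - g z - d * (y - z)) + d * (y - z) by ring.
apply: le_lt_trans (nmD _ _) _; apply: le_lt_trans (lerD H1 (lexx _)) _.
by rewrite nmM -mulrDl mulrC -ltr_pdivlMr.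
Qed.

(* Ekeland's argument: if the value [c] is not taken, then a minimum of
   [|g - c| + m' |. - w|] over a closed disc can be lowered by moving in the
   direction [(c - g) / g']. *)
Lemma covering (g : R[i] -> R[i]) (w c : R[i]) (m r : R) :
  0 < m -> 0 < r ->
  (forall z, nm (z - w) < r -> exists2 d, cdiff g z d & m <= nm d) ->
  nm (c - g w) < m * r -> exists2 z, nm (z - w) < r & g z = c.
Proof.
move=> m0 r0 gd cw.
have [m' [m'0 m'm [r' [r'0 r'r cw']]]] : exists m' : R, [/\ 0 < m', m' < m &
    exists r' : R, [/\ 0 < r', r' < r & nm (c - g w) < m' * r']].
  pose q := nm (c - g w) / (m * r); have q0 : 0 <= q.
    by rewrite divr_ge0 ?nm_ge0 // ltW // mulr_gt0.
  have q1 : q < 1 by rewrite ltr_pdivrMr ?mul1r // mulr_gt0.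
  (* As [(3 + q)^2 - 16 q = (1 - q) (9 - q)], one has [q < t^2 < 1]: both [m] and [r] can be shrunk
     by the factor [t]. *)
  pose t := (3 + q) / 4; have tq : q < t ^+ 2 by rewrite /t; nra.
  have t1 : 0 < t < 1 by rewrite /t; lra.
  case/andP: t1 => t0 t1.
  exists (t * m); split; [exact: mulr_gt0|by rewrite gtr_pMl|].
  exists (t * r); split; [exact: mulr_gt0|by rewrite gtr_pMl|].
  have -> : nm (c - g w) = q * (m * r).
    by rewrite /q divfK // gt_eqF // mulr_gt0.
  rewrite (_ : t * m * (t * r) = t ^+ 2 * (m * r)); last by ring.
  by rewrite ltr_pM2r // mulr_gt0.
pose psi z := nm (g z - c) + m' * nm (z - w).
pose K := [set z | nm (z - w) <= r'].
have lbK : has_inf (psi @` K).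
  split; first by exists (psi w), w => //; rewrite /K /= subrr nm0 ltW.
  by exists 0 => _ [z _ <-]; rewrite addr_ge0 ?mulr_ge0 ?nm_ge0 // ltW.
pose I := inf (psi @` K).
have /choice[u Hu] : forall n : nat, exists z, K z /\ psi z < I + n.+1%:R^-1.
  move=> n; have n0 : 0 < n.+1%:R^-1 :> R by rewrite invr_gt0.
  have [_ [z Kz <-] zI] := inf_adherent n0 lbK.
  by exists z.
have [z Hz] : exists z, forall e : R, 0 < e -> forall N,
    exists2 n, (N <= n)%N & nm (u n - z) < e.
  apply: (@bolzano_weierstrass _ (r' + nm w)) => n.
  rewrite (_ : u n = (u n - w) + w); last by ring.
  apply: le_trans (nmD _ _) _; rewrite lerD //; exact: (Hu n).1.
have Kz : nm (z - w) <= r'.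
  apply/ler_addgt0Pr => e e0; have [n _ un] := Hz _ e0 0%N.
  apply: le_trans (nm_le_dist _ _ (u n)) _.
  by rewrite addrC lerD //; [exact: (Hu n).1|rewrite nmB_sym ltW].
have [d gzd md] := gd _ (le_lt_trans Kz r'r).
have psiz : psi z <= I.
  apply/ler_addgt0Pr => /= e e0.
  have e30 : 0 < e / 3 by rewrite divr_gt0.
  have [e1 e10 He1] := cdiff_ccont gzd e30.
  have m3 : 0 < e / (3 * m') by rewrite divr_gt0 // mulr_gt0.
  have [n nN un] := Hz (Num.min e1 (e / (3 * m'))) (ltac:(by rewrite lt_min e10 m3))
    (Num.truncn (3 / e)).
  move: un; rewrite lt_min => /andP[un1 un2].
  have := (Hu n).2; have := He1 _ un1.
  have H3 : n.+1%:R^-1 < e / 3.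
    rewrite -[e / 3]invf_div ltf_pV2 ?posrE ?divr_gt0 //.
    by rewrite (lt_le_trans (truncnS_gt _)) // ler_nat.
  have H4 : m' * nm (u n - z) < e / 3.
    rewrite -ltr_pdivlMl // (_ : m'^-1 * (e / 3) = e / (3 * m')) //.
    by field; rewrite gt_eqF.
  have H5 : nm (g z - c) <= nm (g (u n) - g z) + nm (g (u n) - c).
    by rewrite (nmB_sym _ (g z)) nm_le_dist.
  have H6 : m' * nm (z - w) <= m' * nm (u n - z) + m' * nm (u n - w).
    by rewrite -mulrDr ler_pM2l // (nmB_sym _ z) nm_le_dist.
  rewrite /psi; move: (n.+1%:R^-1) H3 => N1 H3 H1 H2; lra.
have minz y : nm (y - w) <= r' -> psi z <= psi y.
  move=> Ky; apply: le_trans psiz _; apply: ge_inf; first exact: lbK.2.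
  by exists y.
(* The minimum is at most [psi w < m' r'], so it is attained inside the disc. *)
have zr' : nm (z - w) < r'.
  rewrite -(ltr_pM2l m'0); apply: le_lt_trans (_ : psi z < _).
    by rewrite /psi lerDr nm_ge0.
  apply: le_lt_trans (minz w _) _; first by rewrite subrr nm0 ltW.
  by rewrite /psi subrr nm0 mulr0 addr0 nmB_sym.
exists z; first exact: lt_trans r'r.
apply/eqP; rewrite eq_sym -subr_eq0; apply/negPn/negP => nz.
pose k := c - g z; have k0 : 0 < nm k by rewrite nm_gt0.
have d0 : 0 < nm d by apply: lt_le_trans md.
have dn0 : d != 0 by rewrite -nm_gt0.
have ep0 : 0 < (m - m') / 2 by rewrite divr_gt0 // subr_gt0.
have [e e0 He] := gzd _ ep0.
have r1 : 0 < r' - nm (z - w) by rewrite subr_gt0.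
(* This [t] keeps the step [h = t k / d] within the range of the derivative estimate and [z + h]
   inside the disc. *)
pose t := Num.min 1 (Num.min (e / 2) ((r' - nm (z - w))) * nm d / nm k).
have t0 : 0 < t.
  rewrite lt_min ltr01 divr_gt0 // mulr_gt0 //.
  by rewrite lt_min divr_gt0.
have t1 : t <= 1 by rewrite ge_min lexx.
pose h := t%:C%C * k / d.
have nh : nm h = t * nm k / nm d.
  by rewrite /h !nmM nm_real gtr0_norm // Normc.normcV.
have nh' : nm h <= Num.min (e / 2) (r' - nm (z - w)).
  by rewrite nh ler_pdivrMr // -ler_pdivlMr // /t ge_min lexx orbT.
move: nh'; rewrite le_min => /andP[he hr].
have he' : nm h < e by apply: le_lt_trans he _; lra.
have := minz (z + h) _.
have -> : z + h - w = (z - w) + h by ring.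
have hz : nm (z - w + h) <= nm (z - w) + nm h := nmD _ _.
move=> /(_ ltac:(lra)); rewrite /psi.
have -> : z + h - w = (z - w) + h by ring.
have := He _ he'.
have dh : d * h = t%:C%C * k by rewrite /h mulrC divfK.
(* To first order the step multiplies [g - c] by [1 - t]. The gain [t nm k >= m nm h] exceeds the
   penalty [m' nm h] plus the remainder [(m - m') / 2 nm h]. *)
have -> : g (z + h) - c = (g (z + h) - g z - d * h) - (1 - t)%:C%C * k.
  rewrite dh rmorphB /= /k; ring.
move=> H1 H2.
have H3 := nmB_le (g (z + h) - g z - d * h) ((1 - t)%:C%C * k).
rewrite nmM nm_real ger0_norm ?subr_ge0 // in H3.
have H4 : nm (g z - c) = nm k by rewrite nmB_sym.
have H5 : m' * nm (z - w + h) <= m' * nm (z - w) + m' * nm h.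
  by rewrite -mulrDr ler_pM2l.
have H6 : m * nm h <= t * nm k.
  rewrite nh mulrA ler_pdivrMr // mulrC ler_wpM2l //.
  by rewrite mulr_ge0 // ltW.
have H7 : 0 < nm h by rewrite nh divr_gt0 // mulr_gt0.
have H8 : m' * nm h < m * nm h by rewrite ltr_pM2r.
rewrite H4 in H2; lra.
Qed.

End Compactness.

(** * Complex differentiability of the exponential, sums and products *)

Section ComplexDerivatives.
Context {R : realType}.
Implicit Types (z w h u : R[i]).

Lemma Re_realM (x : R) z : Re (x%:C%C * z) = x * Re z.
Proof. by rewrite ReM /= mul0r subr0. Qed.

Lemma nm_cexpB1 h : nm (cexp h - 1) <= nm h * expR (nm h).
Proof.
have H (s : R) : is_derive s 1 (fun t => t * (nm h * expR (nm h)))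
   (nm h * expR (nm h)) by der; rewrite /=; ring.
have := vector_MVT (fun c => is_derive_cexp_ray c 0 h) H.
cbv beta; rewrite !(rmorph1, rmorph0, mul0r, mul1r, add0r, subr0) cexp0.
apply => s /andP[s0 s1].
rewrite add0r nmM nm_cexp ler_wpM2l ?nm_ge0 // ler_expR Re_realM.
apply: le_trans (ler_norm _) _; rewrite normrM ger0_norm //.
by rewrite (le_trans _ (Re_le_nm h)) // ler_piMl.
Qed.

(** The curve [e^(th) - th] has derivative [h (e^(th) - 1)], to which the first-order bound
    applies. *)
Lemma nm_cexpB1B h : nm (cexp h - 1 - h) <= nm h ^+ 2 * expR (nm h).
Proof.
have H (s : R) : is_derive s 1 (fun t => t * (nm h ^+ 2 * expR (nm h)))
   (nm h ^+ 2 * expR (nm h)) by der; rewrite /=; ring.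
have Hp (c : R[i]) (s : R) :
    is_derive s 1 (fun t => Re (c * (cexp (0 + t%:C%C * h) - t%:C%C * h)))
     (Re (c * (h * cexp (0 + s%:C%C * h) - h))).
  have -> : (fun t => Re (c * (cexp (0 + t%:C%C * h) - t%:C%C * h))) =
      (fun t : R => Re (c * cexp (0 + t%:C%C * h)) - t * Re (c * h)).
    by apply/funext => t; rewrite mulrBr ReD ReN mulrCA Re_realM.
  have E := is_derive_cexp_ray c 0 h s.
  by der; rewrite mulrBr ReD ReN /=; ring.
have := vector_MVT Hp H.
cbv beta; rewrite !(rmorph1, rmorph0, mul0r, mul1r, add0r, subr0) cexp0 addrAC.
apply => s /andP[s0 s1].
rewrite add0r -[X in _ - X]mulr1 -mulrBr nmM expr2 -mulrA ler_wpM2l ?nm_ge0 //.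
have sh : nm (s%:C%C * h) <= nm h.
  by rewrite nmM nm_real ger0_norm // ler_piMl ?nm_ge0.
apply: le_trans (nm_cexpB1 _) _.
by rewrite ler_pM ?nm_ge0 ?expR_ge0 // ler_expR.
Qed.

Lemma cdiff_cexp w : cdiff cexp w (cexp w).
Proof.
move=> e e0; pose k := nm (cexp w) * expR 1.
have k0 : 0 < 1 + k by rewrite ltr_pwDl // mulr_ge0 ?nm_ge0 ?expR_ge0.
exists (Num.min 1 (e / (1 + k))); first by rewrite lt_min ltr01 divr_gt0.
move=> h; rewrite lt_min => /andP[h1 hk].
rewrite cexpD (_ : _ - _ = cexp w * (cexp h - 1 - h)); last by ring.
rewrite nmM; apply: le_trans (_ : nm (cexp w) * (nm h ^+ 2 * expR 1) <= _).
  rewrite ler_wpM2l ?nm_ge0 //; apply: le_trans (nm_cexpB1B _) _.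
  by rewrite ler_wpM2l ?sqr_ge0 // ler_expR ltW.
have -> : nm (cexp w) * (nm h ^+ 2 * expR 1) = (k * nm h) * nm h.
  by rewrite /k; ring.
rewrite ler_wpM2r ?nm_ge0 //; move: hk; rewrite ltr_pdivlMr // => hk.
have := nm_ge0 h; lra.
Qed.

Lemma cdiff_cst (a : R[i]) z : cdiff (fun=> a) z 0.
Proof.
move=> e e0; exists 1 => // h _.
by rewrite subrr mul0r subr0 nm0 mulr_ge0 ?nm_ge0 // ltW.
Qed.

Lemma cdiff_id z : cdiff id z 1.
Proof.
move=> e e0; exists 1 => // h _.
rewrite mul1r (_ : _ - h = 0) ?nm0 ?mulr_ge0 ?nm_ge0 ?ltW //; ring.
Qed.

Lemma cdiffD g k z a b : cdiff g z a -> cdiff k z b ->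
  cdiff (fun y => g y + k y) z (a + b).
Proof.
move=> ga kb e e0; have e20 : 0 < e / 2 by rewrite divr_gt0.
have [r r0 Hr] := ga _ e20; have [s s0 Hs] := kb _ e20.
exists (Num.min r s); first by rewrite lt_min r0.
move=> h; rewrite lt_min => /andP[/Hr H1 /Hs H2].
rewrite (_ : _ - _ = (g (z + h) - g z - a * h) + (k (z + h) - k z - b * h));
  last by ring.
by rewrite (le_trans (nmD _ _)) // [in leRHS](splitr e) mulrDl lerD.
Qed.

Lemma cdiffM g k z a b : cdiff g z a -> cdiff k z b ->
  cdiff (fun y => g y * k y) z (a * k z + g z * b).
Proof.
move=> ga kb e e0; pose A := 1 + nm (k z); pose B := nm a; pose C := nm (g z).
have A0 : 0 < A by rewrite ltr_pwDl // nm_ge0.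
have B0 : 0 < 1 + B by rewrite ltr_pwDl // nm_ge0.
have C0 : 0 < 1 + C by rewrite ltr_pwDl // nm_ge0.
have eA : 0 < e / (3 * A) by rewrite divr_gt0 // mulr_gt0.
have eB : 0 < e / (3 * (1 + B)) by rewrite divr_gt0 // mulr_gt0.
have eC : 0 < e / (3 * (1 + C)) by rewrite divr_gt0 // mulr_gt0.
have [r r0 Hr] := ga _ eA; have [s s0 Hs] := kb _ eC.
have ck := cdiff_ccont kb.
have [d d0 Hd] := ck _ eB; have [d1 d10 Hd1] := ck _ ltr01.
exists (Num.min (Num.min r s) (Num.min d d1)); first by rewrite !lt_min r0 s0 d0.
move=> h; rewrite !lt_min => /andP[/andP[/Hr H1 /Hs H2] /andP[hd hd1]].
have zh : z + h - z = h by ring.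
have := Hd (z + h); rewrite zh => /(_ hd) H3.
have := Hd1 (z + h); rewrite zh => /(_ hd1) H4.
have H5 : nm (k (z + h)) <= A.
  rewrite (_ : k (z + h) = (k (z + h) - k z) + k z); last by ring.
  by rewrite (le_trans (nmD _ _)) // lerD // ltW.
rewrite (_ : _ - _ = (g (z + h) - g z - a * h) * k (z + h)
   + a * h * (k (z + h) - k z) + g z * (k (z + h) - k z - b * h)); last by ring.
have h0 := nm_ge0 h.
have T1 : nm ((g (z + h) - g z - a * h) * k (z + h)) <= e / 3 * nm h.
  rewrite nmM; apply: le_trans (ler_pM (nm_ge0 _) (nm_ge0 _) H1 H5) _.
  rewrite le_eqVlt; apply/orP; left; apply/eqP; field; rewrite gt_eqF //.
have T2 : nm (a * h * (k (z + h) - k z)) <= e / 3 * nm h.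
  rewrite !nmM; apply: le_trans (_ : (1 + B) * nm h * (e / (3 * (1 + B))) <= _).
    rewrite ler_pM ?mulr_ge0 ?nm_ge0 //; last exact: ltW.
    by rewrite ler_wpM2r // /B lerDr.
  by rewrite le_eqVlt; apply/orP; left; apply/eqP; field; rewrite gt_eqF.
have T3 : nm (g z * (k (z + h) - k z - b * h)) <= e / 3 * nm h.
  rewrite !nmM; apply: le_trans (_ : (1 + C) * (e / (3 * (1 + C)) * nm h) <= _).
    by rewrite ler_pM ?nm_ge0 // /C lerDr.
  by rewrite le_eqVlt; apply/orP; left; apply/eqP; field; rewrite gt_eqF.
apply: le_trans (nmD _ _) _; apply: le_trans (lerD (nmD _ _) (lexx _)) _.
lra.
Qed.

Lemma cdiff_derivable g z a : cdiff g z a -> derivable g z 1.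
Proof.
move=> ga; apply/cvg_ex; exists a; apply/cvgrPdist_le => /= e e0.
have [e' ee'] : exists e', e = (e')%:C%C.
  by exists (Re e); move: e0; case: (e) => x y; rewrite ltcE /= => /andP[/eqP->].
move: e0; rewrite ee' => e0; have {}e0 : 0 < e' by move: e0; rewrite ltcR.
have [r r0 Hr] := ga _ e0.
exists (r%:C%C); first by rewrite /= ltcR.
move=> h /=; rewrite sub0r normrN => hr h0.
have nh : 0 < nm h by rewrite nm_gt0.
rewrite normE lecR /GRing.scale /= mulr1.
have -> : a - h^-1 * (g (h + z) - g z) = - (h^-1 * (g (z + h) - g z - a * h)).
  by rewrite (addrC h); field.
rewrite nmN nmM Normc.normcV ler_pdivrMl // [leRHS]mulrC.
by apply: Hr; move: hr; rewrite normE ltcR.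
Qed.

End ComplexDerivatives.

(** * The function [z e^(z+1)]: entire, transcendental, with an invariant disc *)

Section TheFunction.
Context {R : realType}.
Implicit Types (z w h u : R[i]).

Definition zexp z : R[i] := z * cexp (z + 1).

Lemma cdiff_cexp1 z : cdiff (fun y => cexp (y + 1)) z (cexp (z + 1)).
Proof.
move=> e e0; have [r r0 H] := cdiff_cexp (z + 1) e0.
by exists r => // h /H; rewrite (addrAC z 1).
Qed.

Lemma cdiff_zexp z : cdiff zexp z ((1 + z) * cexp (z + 1)).
Proof.
have := cdiffM (cdiff_id z) (cdiff_cexp1 z).
by rewrite mulrDl.
Qed.

Lemma zexp_entire : entire zexp.
Proof. by move=> z; apply: cdiff_derivable (cdiff_zexp z). Qed.

Lemma zexp0 : zexp 0 = 0. Proof. by rewrite /zexp mul0r. Qed.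
Lemma zexpN1 : zexp (- 1) = - 1.
Proof. by rewrite /zexp addNr cexp0 mulr1. Qed.

Lemma cexp_2pin (n : nat) : cexp ((n%:R * (2 * pi)) *i)%C = 1 :> R[i].
Proof.
elim: n => [|n IH]; first by rewrite mul0r cexp0.
have -> : ((n.+1%:R * (2 * pi)) *i)%C = ((n%:R * (2 * pi)) *i)%C + (pi *i)%C + (pi *i)%C :> R[i].
  by apply: ReIm_eq; rewrite !ReImE /= ?addr0 // -addn1 natrD; ring.
by rewrite !cexpD IH cexp_pi; ring.
Qed.

(** At the points [2 pi i n] the function agrees with [e z], so a polynomial equal to it would be
    [e z]; the fixed point [-1] would then give [e = 1]. *)
Lemma zexp_transcendental : transcendental zexp.
Proof.
move=> [p Hp]; pose q := p - (cexp 1 : R[i]) *: 'X.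
have q0 : q = 0.
  apply/eqP/negPn/negP => qn0.
  pose rs := [seq ((n%:R * (2 * pi)) *i)%C : R[i] | n <- iota 0 (size q)].
  have := @max_poly_roots _ q rs qn0; rewrite size_map size_iota ltnn.
  move=> H; suff: false by []; apply: H; last first.
    rewrite map_inj_uniq ?iota_uniq // => n m [] H.
    apply/eqP; rewrite -(eqr_nat R); apply/eqP; apply: mulIf H.
    by rewrite gt_eqF // mulr_gt0 ?pi_gt0.
  apply/allP => _ /mapP[n _ ->]; rewrite /root /q hornerD hornerN hornerZ hornerX.
  rewrite -Hp /zexp cexpD cexp_2pin.
  by rewrite mul1r mulrC subrr.
have := Hp (-1); rewrite zexpN1.
have -> : p = cexp 1 *: 'X by apply/eqP; rewrite -subr_eq0 -/q q0.
rewrite hornerZ hornerX mulrN1 => /oppr_inj.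
have -> : cexp 1 = (expR 1)%:C%C :> R[i] by rewrite -cexp_real.
by move=> [] E; have := expR_ge1Dx (1 : R); rewrite -E; lra.
Qed.

Lemma zexp_eqN1 z : zexp z != -1 -> z != -1.
Proof. by apply: contra_neq => ->; rewrite zexpN1. Qed.

Lemma zexp_ccont z : ccont zexp z.
Proof. exact: cdiff_ccont (cdiff_zexp z). Qed.

Lemma zexp_open z (r : R) : z != -1 -> 0 < r ->
  exists2 s : R, 0 < s & forall c, nm (c - zexp z) < s ->
    exists2 y, nm (y - z) < r & zexp y = c.
Proof.
move=> z1 r0; pose m := nm ((1 + z) * cexp (z + 1)).
have m0 : 0 < m / 2.
  by rewrite divr_gt0 // /m nm_gt0 mulf_neq0 ?cexp_neq0 // addrC addr_eq0.
have cc : ccont (fun y => (1 + y) * cexp (y + 1)) z.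
  apply: cdiff_ccont (cdiffM (cdiffD (cdiff_cst 1 z) (cdiff_id z)) (cdiff_cexp1 z)).
have [d d0 Hd] := cc _ m0.
pose r' := Num.min r d; have r'0 : 0 < r' by rewrite lt_min r0.
exists (m / 2 * r'); first by rewrite mulr_gt0.
move=> c Hc; have [y yr <-] : exists2 y, nm (y - z) < r' & zexp y = c.
  apply: covering Hc => // y; rewrite lt_min => /andP[_ /Hd H].
  exists ((1 + y) * cexp (y + 1)); first exact: cdiff_zexp.
  have := nm_le_dist ((1 + z) * cexp (z + 1)) 0 ((1 + y) * cexp (y + 1)).
  rewrite !subr0 -/m; move: H; rewrite nmB_sym -/m.
  move: (nm _) (nm _) => a b; lra.
by exists y => //; move: yr; rewrite lt_min => /andP[].
Qed.

(* [1 + zexp z = \int_0^1 s u^2 e^{su} ds] with [u = 1 + z], so that any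
   antiderivative of a majorant bounds it. *)
Lemma nm_1Dzexp_le z (q q' : R -> R) :
  (forall s : R, is_derive s 1 q (q' s)) ->
  (forall s : R, 0 <= s <= 1 ->
    s * nm (1 + z) ^+ 2 * expR (s * Re (1 + z)) <= q' s) ->
  nm (1 + zexp z) <= q 1 - q 0.
Proof.
move=> qd le; pose u := 1 + z.
have Hp (c : R[i]) (s : R) : is_derive s 1
     (fun t => Re (c * ((t%:C%C * u - 1) * cexp (0 + t%:C%C * u))))
     (Re (c * (s%:C%C * u ^+ 2 * cexp (0 + s%:C%C * u)))).
  have -> : (fun t => Re (c * ((t%:C%C * u - 1) * cexp (0 + t%:C%C * u)))) =
      (fun t : R => t * Re (c * u * cexp (0 + t%:C%C * u)) -
         Re (c * cexp (0 + t%:C%C * u))).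
    by apply/funext => t; rewrite -Re_realM -ReN -ReD; congr (Re _); ring.
  have E := is_derive_cexp_ray c 0 u s.
  have E' := is_derive_cexp_ray (c * u) 0 u s.
  der; rewrite /= -Re_realM mulr1 -ReN -!ReD; congr (Re _); ring.
have := vector_MVT Hp qd.
have -> : ((1 : R)%:C%C * u - 1) * cexp (0 + (1 : R)%:C%C * u) -
    ((0 : R)%:C%C * u - 1) * cexp (0 + (0 : R)%:C%C * u) = 1 + zexp z.
  rewrite mul0r !add0r mul1r cexp0 /zexp /u (addrC z); ring.
apply=> s s01; apply: le_trans (le s s01); case/andP: s01 => s0 _.
by rewrite expr2 !nmM nm_cexp nm_real ger0_norm // add0r Re_realM -expr2.
Qed.

(** The majorant [s r^2 e^(sr)] has antiderivative [(sr - 1) e^(sr)], which gives the bound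
    [1 + (r - 1) e^r < 1]. *)
Lemma zexp_disc z : nm (1 + z) < 1 -> nm (1 + zexp z) < 1.
Proof.
set r := nm (1 + z) => r1.
have H (s : R) : is_derive s 1 (fun t => (t * r - 1) * expR (t * r))
   (s * r ^+ 2 * expR (s * r)) by der; rewrite /=; ring.
apply: le_lt_trans (nm_1Dzexp_le H _) _.
  move=> s /andP[s0 s1]; rewrite -/r; apply: ler_wpM2l.
    by rewrite mulr_ge0 ?sqr_ge0.
  by rewrite ler_expR ler_wpM2l // (le_trans (ler_norm _)) // Re_le_nm.
rewrite mul1r mul0r expR0 sub0r mulr1 opprK gtrDr.
by rewrite pmulr_llt0 ?expR_gt0 // subr_lt0.
Qed.

(** Away from the fixed point [0] on the boundary of [D], a margin outside [D] is still mapped into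
    [D]: there [Re (1 + z) <= 1 - d^2 / 4], which improves the exponential in the majorant. *)
Lemma zexp_disc_gain (d : R) z : 0 < d -> d <= 1 -> d <= nm z ->
  nm (1 + z) < 1 + d ^+ 2 / 36 -> nm (1 + zexp z) < 1.
Proof.
move=> d0 d1 dz; set r := nm (1 + z) => r1; pose eta := d ^+ 2 / 4.
(* The majorant rests on [e^(s (1 - eta)) <= e^s - eta s] and integrates to [r^2 (1 - eta / 3)]. *)
have H (s : R) : is_derive s 1
   (fun t => r ^+ 2 * ((t - 1) * expR t - eta / 3 * (t * (t * t))))
   (s * r ^+ 2 * (expR s - eta * s)) by der; rewrite /=; field.
have r0 : 0 <= r := nm_ge0 _.
have dd : d * d <= 1 by nra.
have Rez : Re (1 + z) <= 1 - eta.
  have := nm_sq (1 + z); rewrite -/r; have := nm_sq z.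
  rewrite !ReImE /= => E1 E2.
  have : nm z ^+ 2 >= d ^+ 2 by rewrite ler_pXn2r ?nnegrE ?nm_ge0 // ltW.
  rewrite /eta; nra.
apply: le_lt_trans (nm_1Dzexp_le H _) _.
  move=> s /andP[s0 s1]; rewrite -/r; apply: ler_wpM2l.
    by rewrite mulr_ge0 ?sqr_ge0.
  apply: le_trans (_ : expR (s * (1 - eta)) <= _).
    by rewrite ler_expR ler_wpM2l.
  have -> : expR s = expR (s * (1 - eta)) * expR (s * eta).
    by rewrite -expRD; congr expR; ring.
  have eta0 : 0 <= eta <= 1 by rewrite /eta; nra.
  case/andP: eta0 => eta0 eta1.
  have E1 : 1 <= expR (s * (1 - eta)).
    by apply: le_trans (expR_ge1Dx _); rewrite lerDl mulr_ge0 // subr_ge0.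
  have E2 := expR_ge1Dx (s * eta).
  have E3 : 0 <= s * eta by rewrite mulr_ge0.
  nra.
rewrite expR0 (_ : _ - _ = r ^+ 2 * (1 - eta / 3)); last by ring.
(* Multiplied by [1 - eta / 3 = 1 - d^2 / 12], this stays below 1. *)
have r2 : r ^+ 2 <= 1 + d ^+ 2 / 12.
  have : r ^+ 2 <= (1 + d ^+ 2 / 36) ^+ 2.
    have B0 : 0 <= 1 + d ^+ 2 / 36 by rewrite addr_ge0 // divr_ge0 ?sqr_ge0.
    by rewrite ler_pXn2r ?nnegrE // ltW.
  move/le_trans; apply; rewrite !expr2; nra.
rewrite /eta; rewrite !expr2 in r2 *; nra.
Qed.

End TheFunction.

(** * Isolating sets, and connectedness after adding infinity *)

Section Isolation.
Context {R : realType}.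
Implicit Types (z w u q : R[i]) (A U V : set R[i]).

Definition nm_open U :=
  forall z, U z -> exists2 r : R, 0 < r & forall y, nm (y - z) < r -> U y.

(* A bounded set that is open off the critical point [-1] and relatively closed
   in [A]: this survives the passage to images under [zexp]. *)
Definition isolating A V :=
  [/\ forall z, V z -> z != -1 ->
        exists2 r : R, 0 < r & forall y, nm (y - z) < r -> V y,
      exists M : R, forall z, V z -> nm z <= M
    & forall q, A q ->
        (forall e : R, 0 < e -> exists2 v, V v & nm (v - q) < e) -> V q].

Lemma nbhs_nm z (P : set R[i]) : nbhs z P ->
  exists2 r : R, 0 < r & forall y, nm (y - z) < r -> P y.
Proof.
move=> /nbhs_ballP[e /= e0 H].
have [e' ee'] : exists e', e = (e')%:C%C.
  by exists (Re e); move: e0; case: (e) => x y; rewrite ltcE /= => /andP[/eqP->].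
move: e0 H; rewrite ee' ltcR => e0 H; exists e' => // y yz; apply: H.
by rewrite -ball_normE /= normE ltcR nmB_sym.
Qed.

Lemma compact_nm_bounded (W : set R[i]) : compact W ->
  exists M : R, forall z, W z -> nm z <= M.
Proof.
move=> cW.
have cn : continuous (fun z : R[i] => nm z : R).
  move=> z P /nbhs_ballP[e /= e0 H]; apply/nbhs_ballP.
  exists e%:C%C => [|y]; first by rewrite /= ltcR.
  rewrite -ball_normE /= normE ltcR => zy; apply: H; rewrite -ball_normE /=.
  apply: le_lt_trans zy.
  have := nmD (z - y) y; have := nmD (y - z) z.
  rewrite !subrK (nmB_sym y z) ler_norml; lra.
have /compact_bounded[M [Mreal HM]] : compact ((fun z : R[i] => nm z : R) @` W).
  by apply: continuous_compact cW; exact: continuous_subspaceT.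
exists (M + 1) => z Wz; have := HM (M + 1); rewrite ltrDl ltr01 => /(_ isT).
by move=> /(_ (nm z)) H; apply: le_trans (ler_norm _) (H _); exists z.
Qed.

(** [O] and [K] may overlap off [A], so [O] need not be isolating. The union [U] of the discs
    [B(p, r)] with [p] in [A] and [B(p, 2r)] inside [O] is; it is bounded because [K] is a
    neighbourhood of infinity. *)
Lemma no_piece_off_infty A (O K : set (riemann_sphere R)) :
  (forall U, nm_open U -> isolating A U -> forall z, U z -> A z -> False) ->
  open O -> open K -> K None ->
  (forall z, A z -> O (Some z) \/ K (Some z)) ->
  (forall z, A z -> O (Some z) -> K (Some z) -> False) ->
  forall z, A z -> O (Some z) -> False.
Proof.
move=> noU oO oK KN cov dis z Az Oz.
pose good p (r : R) := [/\ A p, O (Some p), 0 < r, r <= 1 &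
  forall y, nm (y - p) < 2 * r -> O (Some y)].
pose U : set R[i] := [set y | exists p r, good p r /\ nm (y - p) < r].
have goodE p : A p -> O (Some p) -> exists r, good p r.
  move=> Ap Op; have /nbhs_nm[r r0 H] : nbhs p (fun y => O (Some y)).
    by have := open_nbhs_nbhs (conj oO Op); apply.
  exists (Num.min 1 (r / 2)); split => //; first by rewrite lt_min ltr01 divr_gt0.
    by rewrite ge_min lexx.
  move=> y yp; apply: H; apply: lt_le_trans yp _.
  have : Num.min 1 (r / 2) <= r / 2 by rewrite ge_min lexx orbT.
  lra.
have oU : nm_open U.
  move=> y [p [r [g yp]]]; exists (r - nm (y - p)); first by rewrite subr_gt0.
  move=> x xy; exists p, r; split=> //; apply: le_lt_trans (nm_le_dist _ _ y) _.
  lra.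
apply: (noU U oU _ z) => //; last first.
  have [r g] := goodE _ Az Oz; exists z, r; split=> //.
  by rewrite subrr nm0; case: g.
split; first by move=> y /oU.
  have [W [cW _] WK] : nbhs (None : riemann_sphere R) K.
    exact: open_nbhs_nbhs (conj oK KN).
  have [M HM] := compact_nm_bounded cW.
  exists (M + 1) => y [p [r [[Ap Op r0 r1 _] yp]]].
  have Wp : W p.
    apply: contrapT => nW; apply: (dis p Ap Op); apply: WK; left.
    by exists p.
  rewrite (_ : y = p + (y - p)); last by ring.
  apply: le_trans (nmD _ _) _; rewrite lerD ?HM //.
  by apply: ltW; apply: lt_le_trans r1.
move=> q Aq clq; have [Oq|Kq] := cov _ Aq.
  by have [r g] := goodE _ Aq Oq; exists q, r; split=> //; rewrite subrr nm0; case: g.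
have /nbhs_nm[e e0 He] : nbhs q (fun y => K (Some y)).
  by have := open_nbhs_nbhs (conj oK Kq); apply.
have e30 : 0 < e / 3 by rewrite divr_gt0.
have [v [p [r [[Ap Op r0 r1 H] vp]]] vq] := clq _ e30.
have pq := nm_le_dist q p v; rewrite nmB_sym in vq.
(* If [q] is in [B(p, 2r)], it lies in both [O] and [K]; otherwise [r < e / 3], and the centre [p]
   lies in both. *)
have [lt2r|ge2r] := ltP (nm (q - p)) (2 * r).
  by case: (dis q Aq (H _ lt2r) Kq).
case: (dis p Ap Op); apply: He; rewrite nmB_sym; lra.
Qed.

(** Of a relatively clopen part and its complement, the one that misses infinity is empty by
    [no_piece_off_infty]. *)
Lemma connected_add_infty A :
  (forall U, nm_open U -> isolating A U -> forall z, U z -> A z -> False) ->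
  connected (add_infty A).
Proof.
move=> noU B [b Bb] [ O oO BO] [K cK BK].
have ND : add_infty A None by right.
have SD z : A z -> add_infty A (Some z) by move=> Az; left; exists z.
have OK x : add_infty A x -> (O x <-> K x).
  move=> Ax.
  have E1 : B x <-> (add_infty A `&` O) x by rewrite -BO.
  have E2 : B x <-> (add_infty A `&` K) x by rewrite -BK.
  by rewrite /setI /= in E1 E2; tauto.
have [KN|nKN] := pselect (K None).
  rewrite BK; apply/seteqP; split=> [x []//|x Ax]; split=> //.
  apply: contrapT => nK.
  have [[z Az zx]|xN] := Ax; last by apply: nK; rewrite xN.
  rewrite -zx in nK.
  apply: (@no_piece_off_infty A (~` K) O noU _ oO _ _ _ z) => //.
  - exact: closed_openC.
  - exact/(OK None).
  - by move=> y Ay; have := OK _ (SD _ Ay); have [|] := pselect (K (Some y)); tauto.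
  - by move=> y Ay nKy /(OK _ (SD _ Ay)).
exfalso; move: Bb; rewrite BO => -[[[z Az <-]|->] Ob].
  apply: (@no_piece_off_infty A O (~` K) noU oO _ _ _ _ z) => //.
  - exact: closed_openC.
  - by move=> y Ay; have := OK _ (SD _ Ay); have [|] := pselect (K (Some y)); tauto.
  - by move=> y Ay /(OK _ (SD _ Ay)) Ky nKy.
exact/nKN/(OK None).
Qed.

(** Points other than [-1] have only preimages other than [-1], where [zexp] is open. For
    closedness, preimages of a converging sequence accumulate at some [u], which backward invariance
    puts in [A], hence in [V]. *)
Lemma isolating_image A V : (forall z, A (zexp z) -> A z) ->
  isolating A V -> isolating A (zexp @` V).
Proof.
move=> bA [oV [M HM] clV]; split.
- move=> _ [u Vu <-] fu1; have u1 := zexp_eqN1 fu1.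
  have [r r0 H] := oV _ Vu u1; have [s s0 Hs] := zexp_open u1 r0.
  by exists s => // y /Hs[v vu <-]; exists v => //; apply: H.
- exists (M * expR (M + 1)) => _ [u Vu <-]; rewrite /zexp nmM nm_cexp.
  rewrite ler_pM ?nm_ge0 ?expR_ge0 ?HM // ler_expR !ReImE /= lerD2r.
  by rewrite (le_trans (ler_norm _)) // (le_trans (Re_le_nm _)) // HM.
move=> q Aq clq.
have /choice[v Hv] : forall n : nat, exists v, V v /\ nm (zexp v - q) < n.+1%:R^-1.
  move=> n; have n0 : 0 < n.+1%:R^-1 :> R by rewrite invr_gt0.
  by have [_ [v Vv <-] H] := clq _ n0; exists v.
have [u Hu] := @bolzano_weierstrass R v M (fun n => HM _ (Hv n).1).
have fu : zexp u = q.
  apply/eqP; rewrite -subr_eq0 -nm_eq0; apply/eqP/le_anti; rewrite nm_ge0 andbT.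
  apply/ler_addgt0Pr => /= e e0; have e20 : 0 < e / 2 by rewrite divr_gt0.
  have [d d0 Hd] := zexp_ccont u e20.
  have [n nN /Hd un] := Hu _ d0 (Num.truncn (2 / e)).
  have Hn : n.+1%:R^-1 < e / 2.
    rewrite -[e / 2]invf_div ltf_pV2 ?posrE ?divr_gt0 //.
    by rewrite (lt_le_trans (truncnS_gt _)) // ler_nat.
  have := nm_le_dist (zexp u) q (zexp (v n)); rewrite nmB_sym in un.
  have := (Hv n).2; move: (n.+1%:R^-1) Hn => N1; lra.
exists u => //; apply: clV; first by apply: bA; rewrite fu.
by move=> e e0; have [n _ H] := Hu _ e0 0%N; exists (v n) => //; apply: (Hv n).1.
Qed.

Lemma image_iterS V n : iter n.+1 zexp @` V = zexp @` (iter n zexp @` V).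
Proof.
apply/seteqP; split=> [_ [x Vx <-]|_ [_ [x Vx <-] <-]]; last by exists x.
by exists (iter n zexp x) => //; exists x.
Qed.

Lemma isolating_iter A V n : (forall z, A (zexp z) -> A z) ->
  isolating A V -> isolating A (iter n zexp @` V).
Proof.
move=> bA iV; elim: n => [|n IH].
  by rewrite (_ : _ @` _ = V) //; apply/seteqP; split=> [_ [x Vx <-]|x Vx] //; exists x.
rewrite image_iterS; exact: isolating_image.
Qed.

(** The supremum of the times up to which the curve stays in [V] is attained by relative closedness,
    and is not less than [b] by openness off [-1]. A curve that goes beyond the bound of [V] is then
    a contradiction. *)
Lemma isolating_curve A V (tau : R -> R[i]) (a b : R) : isolating A V -> a <= b ->
  (forall t, a <= t <= b -> A (tau t) /\ tau t != -1) ->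
  (forall t, a <= t <= b -> forall e : R, 0 < e -> exists2 d : R, 0 < d &
     forall s, a <= s <= b -> `|s - t| < d -> nm (tau s - tau t) < e) ->
  V (tau a) -> V (tau b).
Proof.
move=> [oV _ clV] ab At ct Va.
pose S := [set t : R | a <= t <= b /\ forall s, a <= s <= t -> V (tau s)].
have Sa : S a.
  by split=> [|s /le_anti <-] //; rewrite lexx ab.
have supS : has_sup S by split; [exists a|exists b => t [/andP[]]].
pose c := sup S.
have ac : a <= c by apply: ub_le_sup => //; exact: supS.2.
have cb : c <= b by apply: ge_sup; [exists a|move=> t [/andP[]]].
have cI : a <= c <= b by rewrite ac cb.
have below s : a <= s -> s < c -> V (tau s).
  move=> as' sc; have d0 : 0 < c - s by rewrite subr_gt0.
  have [t [_ Ht]] := sup_adherent d0 supS.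
  by rewrite -/c opprB addrC subrK => st; apply: Ht; rewrite as' ltW.
have Vc : V (tau c).
  apply: clV; first exact: (At _ cI).1.
  move=> e e0; have [d d0 Hd] := ct _ cI _ e0.
  have [t St] := sup_adherent d0 supS; rewrite -/c => tc.
  have tc' : t <= c by apply: ub_le_sup => //; exact: supS.2.
  exists (tau t); first by apply: St.2; rewrite lexx andbT; case/andP: St.1.
  apply: Hd; first exact: St.1.
  by rewrite distrC ger0_norm ?subr_ge0 // ltrBlDr -ltrBlDl.
have [r r0 Hr] := oV _ Vc (At _ cI).2.
have [d d0 Hd] := ct _ cI _ r0.
have near s : a <= s <= b -> `|s - c| < d -> V (tau s).
  by move=> sI sd; apply: Hr; apply: Hd.
have [cb'|bc] := ltP c b; last by rewrite (_ : b = c) //; apply/le_anti/andP.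
pose c' := Num.min b (c + d / 2).
have cc' : c < c' by rewrite lt_min cb' ltrDl divr_gt0.
have c'b : c' <= b by rewrite ge_min lexx.
have c'd : c' <= c + d / 2 by rewrite ge_min lexx orbT.
suff : c' <= c by rewrite leNgt cc'.
apply: ub_le_sup; first exact: supS.2.
split; first by rewrite c'b (le_trans ac) // ltW.
move=> s /andP[as' sc']; have [sc|cs] := ltP s c; first exact: below.
apply: near; first by rewrite as' (le_trans sc').
rewrite ger0_norm ?subr_ge0 //; lra.
Qed.

End Isolation.

(** * Growth of discs in the logarithmic coordinate *)

Section LogarithmicDiscs.
Context {R : realType}.
Implicit Types (z w h y : R[i]) (U V : set R[i]) (r : R).

Definition flog w : R[i] := w + 1 + cexp w.

Lemma zexp_cexp w : zexp (cexp w) = cexp (flog w).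
Proof. by rewrite /zexp -cexpD /flog; congr cexp; ring. Qed.

Lemma iter_zexp_cexp n w : iter n zexp (cexp w) = cexp (iter n flog w).
Proof. by elim: n => // n IH; rewrite !iterS IH zexp_cexp. Qed.

Lemma cdiff_flog w : cdiff flog w (1 + cexp w).
Proof.
have := cdiffD (cdiffD (cdiff_id w) (cdiff_cst 1 w)) (cdiff_cexp w).
by rewrite addr0.
Qed.

Definition contains_disc V w r := forall y, nm (y - w) < r -> V (cexp y).

Lemma contains_disc_le V w r r' : r' <= r ->
  contains_disc V w r -> contains_disc V w r'.
Proof. by move=> rr' H y yr; apply: H; apply: lt_le_trans rr'. Qed.

(** The lift [flog] has derivative [1 + cexp]; [covering] turns a lower bound on it into growth of
    the radius. *)
Lemma contains_disc_zexp V w r (m : R) : 0 < m -> 0 < r -> contains_disc V w r ->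
  (forall y, nm (y - w) < r -> m <= nm (1 + cexp y)) ->
  contains_disc (zexp @` V) (flog w) (m * r).
Proof.
move=> m0 r0 HV Hm y yw.
have [v vw <-] : exists2 v, nm (v - w) < r & flog v = y.
  apply: covering yw => // v vw; exists (1 + cexp v); first exact: cdiff_flog.
  exact: Hm.
by exists (cexp v); [apply: HV|rewrite zexp_cexp].
Qed.

Lemma nm_open_contains_disc U z : nm_open U -> U z -> z != 0 ->
  exists w r, [/\ cexp w = z, 0 < r & contains_disc U w r].
Proof.
move=> oU Uz z0; have [w wz _] := cexp_log z0.
have [r r0 Hr] := oU _ Uz.
have [d d0 Hd] := cdiff_ccont (cdiff_cexp w) r0.
exists w, d; split=> // y yw; apply: Hr; rewrite -wz; exact: Hd.
Qed.

Lemma nm_i (x : R) : nm (x *i)%C = `|x| :> R.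
Proof. by rewrite /nm /= expr0n add0r sqrtr_sqr. Qed.

(** A vertical move of length at most [pi] from the centre cancels the argument of [cexp w]. *)
Lemma contains_disc_positive V w r : pi < r -> contains_disc V w r ->
  exists2 x : R, 0 < x & V x%:C%C.
Proof.
move=> rpi HV; have [v vw v1] := cexp_log (cexp_neq0 w).
exists (expR (Re v)); first exact: expR_gt0.
have -> : (expR (Re v))%:C%C = cexp (w - ((Im v) *i)%C).
  rewrite cexpD -vw -cexpD -cexp_real; congr cexp.
  by apply: ReIm_eq; rewrite !ReImE /=; ring.
apply: HV; rewrite (_ : _ - w = - ((Im v) *i)%C); last by ring.
by rewrite nmN nm_i (le_lt_trans v1).
Qed.

Lemma contains_disc_negative V w r : pi < r -> contains_disc V w r ->
  exists2 x : R, 0 < x & V (- x)%:C%C.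
Proof.
move=> rpi HV; have nw : - cexp w != 0 by rewrite oppr_eq0 cexp_neq0.
have [v vw v1] := cexp_log nw.
exists (expR (Re v)); first exact: expR_gt0.
have -> : (- expR (Re v))%:C%C = cexp (w - ((Im v) *i)%C).
  rewrite cexpD (_ : cexp w = - cexp v); last by rewrite vw opprK.
  rewrite mulNr -cexpD rmorphN /= -cexp_real; congr (- cexp _).
  by apply: ReIm_eq; rewrite !ReImE /=; ring.
apply: HV; rewrite (_ : _ - w = - ((Im v) *i)%C); last by ring.
by rewrite nmN nm_i (le_lt_trans v1).
Qed.

Lemma expR_half_le2 (x : R) : x <= 1 / 2 -> expR x <= 2.
Proof.
move=> x2; have := expR_ge1Dx (- x); rewrite expRN => H.
have H2 : 1 / 2 <= (expR x)^-1 by lra.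
rewrite -[2]invrK -[expR x]invrK lef_pV2 ?posrE ?invr_gt0 ?expR_gt0 //.
lra.
Qed.

Lemma nm_1Dcexp_disc w y r : r <= 1 / 2 -> nm (y - w) < r ->
  nm (1 + cexp w) - 2 * r * nm (cexp w) <= nm (1 + cexp y).
Proof.
move=> r2 yw; have E : cexp y = cexp w + cexp w * (cexp (y - w) - 1).
  by rewrite mulrBr mulr1 -cexpD addrCA subrr addr0 (addrC w) subrK.
rewrite E addrA; apply: le_trans (nm_geB _ _); rewrite lerD2l lerN2 nmM.
rewrite mulrC ler_wpM2r ?nm_ge0 //; apply: le_trans (nm_cexpB1 _) _.
rewrite mulrC ler_pM ?nm_ge0 ?expR_ge0 ?expR_half_le2 ?ltW //.
exact: lt_le_trans r2.
Qed.

(** The margin of [zexp_disc_gain] for [d = 1/4]. *)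
Definition kappa : R := (1 / 4) ^+ 2 / 36.

Lemma kappa_gt0 : 0 < kappa.
Proof. by rewrite /kappa divr_gt0 // exprn_gt0 // divr_gt0. Qed.

Lemma kappa_le : kappa <= 1 / 16.
Proof. by rewrite /kappa expr2; lra. Qed.

Lemma zexp_disc_gain_kappa z : 1 / 4 <= nm z -> 1 <= nm (1 + zexp z) ->
  1 + kappa <= nm (1 + z).
Proof.
move=> z4 f1; rewrite leNgt; apply/negP => H.
have [H1 H2] : 0 < 1 / 4 :> R /\ 1 / 4 <= 1 :> R by lra.
by have := zexp_disc_gain H1 H2 z4 H; rewrite ltNge f1.
Qed.

Lemma nm_zexp_small z : nm z < 1 / 4 -> 3 / 2 * nm z <= nm (zexp z).
Proof.
move=> z4; rewrite /zexp nmM mulrC ler_wpM2l ?nm_ge0 // nm_cexp.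
apply: le_trans (expR_ge1Dx _); rewrite !ReImE /=.
have := Re_le_nm z; rewrite ler_norml; lra.
Qed.

(* Along an orbit outside the unit disc about [-1], logarithmic discs of radius
   [rho / (1 + kappa min |z| (1/2))] are mapped over each other: the loss of
   size [O(rho |z|)] near [0] is paid for by the growth of [|z|] there. *)
Definition lyapunov_radius (rho x : R) := rho / (1 + kappa * Num.min x (1 / 2)).

Lemma contains_disc_lyapunov V w (rho : R) :
  0 < rho -> rho <= kappa / 16 -> 1 <= nm (1 + cexp w) ->
  1 <= nm (1 + zexp (cexp w)) ->
  contains_disc V w (lyapunov_radius rho (nm (cexp w))) ->
  contains_disc (zexp @` V) (flog w)
    (lyapunov_radius rho (nm (cexp (flog w)))).
Proof.
move=> rho0 rho1 w1 fw1; rewrite -zexp_cexp.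
set z := cexp w; set x := nm z; set x' := nm (zexp z) => HV.
have x0 : 0 < x by rewrite nm_gt0 cexp_neq0.
have x'0 : 0 <= x' := nm_ge0 _.
have zgain (x4 : 1 / 4 <= x) := zexp_disc_gain_kappa x4 fw1.
rewrite /lyapunov_radius in HV *; have k0 := kappa_gt0; have k1 := kappa_le.
move: (kappa) k0 k1 rho1 zgain HV => k k0 k1 rho1 zgain HV.
pose den (t : R) := 1 + k * Num.min t (1 / 2).
have den1 t : 0 <= t -> 1 <= den t /\ den t <= 1 + k / 2.
  move=> t0; have /andP[a b] : 0 <= Num.min t (1 / 2) <= 1 / 2.
    by rewrite ge_min lexx orbT le_min t0 divr_ge0.
  split; first by rewrite lerDl mulr_ge0 // ltW.
  by rewrite lerD2l ler_pM2l //; move: b; rewrite !mul1r.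
have [d1 d2] := den1 _ (ltW x0); have [d1' d2'] := den1 _ x'0.
have dp : 0 < den x by lra.
have dp' : 0 < den x' by lra.
have radle : rho / den x <= rho.
  by rewrite ler_pdivrMr // ler_pMr.
have rad0 : 0 < rho / den x by rewrite divr_gt0.
have Hy y : nm (y - w) < rho / den x ->
    nm (1 + z) - 2 * rho * x <= nm (1 + cexp y).
  move=> yw; apply: nm_1Dcexp_disc; last exact: lt_le_trans radle.
  lra.
(* [m] has to bound the derivative of the lift from below on the disc, and [m] times the old radius
   has to cover the new one. *)
suff [m m0 [Hm Hd]] : exists2 m, 0 < m &
    m <= nm (1 + z) - 2 * rho * x /\ den x <= m * den x'.
  apply: (@contains_disc_le _ _ (m * (rho / den x))); last first.
    apply: contains_disc_zexp => // y /Hy; exact: le_trans.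
  rewrite mulrCA ler_pM2l //.
  by rewrite ler_pdivlMr // ler_pdivrMl // mulrC.
have rx : rho * x <= k / 16 * x by apply: ler_wpM2r => //; exact: ltW.
have kx : k * x <= 1 / 16 * x by apply: ler_wpM2r => //; exact: ltW.
have kx0 : 0 < k * x by rewrite mulr_gt0.
(* Away from 0 the derivative at the centre is at least [1 + k], and at least [x - 1]. Less its
   variation over the disc, it still exceeds [1 + k / 2], which bounds the ratio of any two
   radii. *)
have [x4|x4] := leP (1 / 4) x.
  exists (1 + k / 2); first lra.
  have zg := zgain x4.
  have zx : x - 1 <= nm (1 + z) by have := nm_geB z 1; rewrite nm1 (addrC z).
  split; last by apply: le_trans d2 _; rewrite ler_peMr //; lra.
  have [x5|x5] := leP x 4; last lra.
  have : k * x <= k * 4 by rewrite ler_pM2l.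
  lra.
(* Near 0 the derivative may fall short of 1 by [2 rho x], but [|z|] grows by a factor [3/2], so the
   required radius shrinks by more. *)
have m0 : 0 < 1 - 2 * rho * x by lra.
exists (1 - 2 * rho * x) => //.
split; first by rewrite lerD2r.
have x32 : 3 / 2 * x <= x' := nm_zexp_small x4.
have -> : den x = 1 + k * x.
  by rewrite /den; case: (leP x (1 / 2)) => // H; lra.
have rxx : rho * x * (k * x) <= rho * x.
  by rewrite ler_piMr ?mulr_ge0 ?ltW //; lra.
apply: le_trans (_ : (1 - 2 * rho * x) * (1 + k * (3 / 2 * x)) <= _); first lra.
rewrite ler_pM2l // /den lerD2l ler_pM2l //.
by case: (leP x' (1 / 2)) => H //; lra.
Qed.

(** The images contain logarithmic discs of radius at least [rho / 2] along the whole orbit. When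
    the orbit is far out, the derivative stretches such a disc to radius [2 pi], whose exponential
    meets the positive axis. *)
Lemma blowup_positive U z : nm_open U -> U z ->
  (forall i, 1 <= nm (1 + iter i zexp z)) ->
  (forall M : R, exists i, M < nm (iter i zexp z)) ->
  exists n, exists2 x : R, 0 < x & (iter n zexp @` U) x%:C%C.
Proof.
move=> oU Uz out unb.
have z0 : z != 0.
  apply/eqP => z0; have [ i ] := unb 1; rewrite z0.
  have -> : iter i zexp 0 = 0 :> R[i] by elim: i => // i; rewrite iterS => ->; rewrite zexp0.
  by rewrite nm0 ltr10.
have [w [r [wz r0 HU]]] := nm_open_contains_disc oU Uz z0.
have k0 := kappa_gt0; have k1 := kappa_le.
pose rho := Num.min r (kappa / 16).
have rho0 : 0 < rho by rewrite lt_min r0 divr_gt0.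
have rho1 : rho <= kappa / 16 by rewrite ge_min lexx orbT.
have orb i : iter i zexp z = cexp (iter i flog w) by rewrite -wz iter_zexp_cexp.
have den0 (x : R) : 0 <= x -> 1 <= 1 + kappa * Num.min x (1 / 2) <= 2.
  move=> x0; have : 0 <= Num.min x (1 / 2) <= 1 / 2.
    by rewrite ge_min lexx orbT le_min x0 divr_ge0.
  move: (Num.min _ _) => t /andP[t0 t1].
  have : 0 <= kappa * t by rewrite mulr_ge0 // ltW.
  have : kappa * t <= 1 / 16 * t by rewrite ler_wpM2r.
  lra.
have discs i : contains_disc (iter i zexp @` U) (iter i flog w)
    (lyapunov_radius rho (nm (cexp (iter i flog w)))).
  elim: i => [|i IH].
    apply: contains_disc_le (_ : contains_disc _ _ r); last first.
      by move=> y /HU Uy; exists (cexp y).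
    have /andP[d1 d2] := den0 _ (nm_ge0 (cexp w)).
    rewrite /lyapunov_radius ler_pdivrMr; last lra.
    apply: le_trans (_ : r <= _); first by rewrite ge_min lexx.
    by rewrite ler_pMr.
  rewrite image_iterS iterS; apply: contains_disc_lyapunov => //.
    by rewrite -orb.
  by rewrite -orb -iterS.
(* Beyond modulus [X] the derivative is at least [4 pi / rho] on the whole disc of radius
   [rho / 2]. *)
pose X : R := 8 * (1 + 4 * pi / rho).
have pir : 0 < pi / rho :> R by rewrite divr_gt0 ?pi_gt0.
have [i Hi] := unb X; rewrite orb in Hi.
set wi := iter i flog w in Hi.
have di : contains_disc (iter i zexp @` U) wi (rho / 2).
  apply: contains_disc_le (discs i); rewrite /lyapunov_radius.
  have /andP[d1 d2] := den0 _ (nm_ge0 (cexp wi)).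
  by rewrite ler_pM2l // lef_pV2 ?posrE //; lra.
have m0 : 0 < 4 * pi / rho :> R by rewrite divr_gt0 // mulr_gt0 // pi_gt0.
have big y : nm (y - wi) < rho / 2 -> 4 * pi / rho <= nm (1 + cexp y).
  move=> yw; have rho2 : rho / 2 <= 1 / 2 by lra.
  apply: le_trans (nm_1Dcexp_disc rho2 yw).
  have := nm_geB (cexp wi) 1; rewrite nm1 (addrC _ 1) => H.
  have rx : rho * nm (cexp wi) <= 1 / 16 * nm (cexp wi).
    by apply: ler_wpM2r; [exact: nm_ge0|lra].
  move: (4 * pi / rho) m0 @X Hi => q m0 X; rewrite /X => Hi; lra.
have rho20 : 0 < rho / 2 by rewrite divr_gt0.
have := contains_disc_zexp m0 rho20 di big; rewrite -image_iterS.
have -> : 4 * pi / rho * (rho / 2) = 2 * pi by field; rewrite gt_eqF.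
have pi2 : pi < 2 * pi :> R by have := pi_gt0 R; lra.
move=> /(contains_disc_positive pi2) [x x0 Vx].
by exists i.+1; exists x.
Qed.

(** Otherwise all logarithmic discs in the images have radius at most [pi], and the derivative of
    the lift is at least 1 on them. Those with [|e^w| >= 1/4] at the centre grow by a fixed factor,
    and the others get there in finitely many steps, so the radii would be unbounded. *)
Lemma blowup_bounded U z' : nm_open U -> U z' ->
  exists n p, (iter n zexp @` U) p /\
    (nm (1 + p) < 1 \/ exists2 x : R, 0 < x & p = (- x)%:C%C).
Proof.
move=> oU Uz'; apply: contrapT => no.
(* The point 0 has no logarithm, so it is replaced by a nearby one. *)
have [z Uz z0] : exists2 z, U z & z != 0.
  have [z0|] := eqVneq z' 0; last by exists z'.
  have [r r0 Hr] := oU _ Uz'; exists (z' + (r / 2)%:C%C).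
    apply: Hr; rewrite addrC addKr nm_real ger0_norm; lra.
  rewrite z0 add0r -nm_gt0 nm_real ger0_norm; lra.
have out n p : (iter n zexp @` U) p -> 1 <= nm (1 + p).
  by move=> Vp; rewrite leNgt; apply/negP => H; apply: no; exists n, p; split; [|left].
have radpi n w r : contains_disc (iter n zexp @` U) w r -> r <= pi.
  move=> H; rewrite leNgt; apply/negP => rpi.
  have [x x0 Vx] := contains_disc_negative rpi H.
  by apply: no; exists n, (- x)%:C%C; split=> //; right; exists x.
(* If [|e^w| >= 1/4], all points of a disc of radius at most [pi] about [w] have exponentials of
   modulus at least [d], so [zexp_disc_gain] gives the factor [1 + k]. *)
pose d : R := expR (- pi) / 4.
have d0 : 0 < d by rewrite divr_gt0 ?expR_gt0.
have d1 : d <= 1.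
  have : expR (- pi) <= expR 0 :> R by rewrite ler_expR oppr_le0 pi_ge0.
  by rewrite expR0 /d; lra.
pose k := d ^+ 2 / 36; have k0 : 0 < k by rewrite divr_gt0 // exprn_gt0.
have gain n w r : 0 < r -> 1 / 4 <= nm (cexp w) ->
    contains_disc (iter n zexp @` U) w r ->
    contains_disc (iter n.+1 zexp @` U) (flog w) ((1 + k) * r).
  move=> r0 w4 Hd; rewrite image_iterS.
  apply: contains_disc_zexp => // [|y yw]; first by rewrite ltr_wpDr // ltW.
  rewrite leNgt; apply/negP => H.
  have dy : d <= nm (cexp y).
    have rpi := radpi _ _ _ Hd.
    have wy : Re w - pi <= Re y.
      by have := Re_le_nm (y - w); rewrite !ReImE ler_norml; lra.
    rewrite nm_cexp in w4; rewrite nm_cexp.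
    apply: le_trans (_ : expR (Re w) * expR (- pi) <= _); last first.
      by rewrite -expRD ler_expR.
    have -> : d = 1 / 4 * expR (- pi) by rewrite /d; lra.
    by rewrite ler_wpM2r ?expR_ge0.
  have := zexp_disc_gain d0 d1 dy H; rewrite ltNge (out n.+1) //.
  by rewrite image_iterS; exists (cexp y) => //; apply: Hd.
have step n w r : 0 < r -> contains_disc (iter n zexp @` U) w r ->
    exists n' w', contains_disc (iter n' zexp @` U) w' ((1 + k) * r).
  (* [N] bounds the waiting time: while [|e^w| < 1/4], each step raises [Re w] by at least [3/4],
     and [Re w >= 0] ends the wait. *)
  have [N] : exists N : nat, - (N%:R * (3 / 4)) <= Re w.
    have [N HN] : exists N : nat, 2 * `|Re w| < N%:R.
      by exists (Num.truncn (2 * `|Re w|)).+1; exact: truncnS_gt.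
    exists N; have := ler_norm (- Re w); have := normr_ge0 (Re w).
    by rewrite normrN; lra.
  elim: N n w => [|N IH] n w HN r0 Hd.
    exists n.+1, (flog w); apply: gain => //.
    rewrite nm_cexp; have := expR_ge1Dx (Re w); move: HN; rewrite mul0r oppr0; lra.
  have [w4|w4] := leP (1 / 4) (nm (cexp w)).
    by exists n.+1, (flog w); apply: gain.
  apply: (IH n.+1 (flog w)) => //.
    have -> : Re (flog w) = Re w + 1 + Re (cexp w) by rewrite !ReD.
    have := Re_le_nm (cexp w); rewrite ler_norml.
    by move: HN; rewrite -(natr1 N); lra.
  rewrite -[r]mul1r image_iterS; apply: contains_disc_zexp => // y yw.
  by apply: (out n); apply: Hd.
have [w [r [_ r0 HU]]] := nm_open_contains_disc oU Uz z0.
have grow N : exists n w', contains_disc (iter n zexp @` U) w' ((1 + k) ^+ N * r).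
  elim: N => [|N [n [w' IH]]].
    by exists 0%N, w; rewrite expr0 mul1r => y /HU Uy; exists (cexp y).
  rewrite exprS -mulrA; apply: step IH.
  by rewrite mulr_gt0 // exprn_gt0 // ltr_wpDr // ltW.
have bern N : 1 + N%:R * k <= (1 + k) ^+ N.
  elim: N => [|N IH]; first by rewrite mul0r addr0 expr0.
  have N0 : 0 <= N%:R :> R by [].
  rewrite exprS -addn1 natrD; apply: le_trans (_ : (1 + k) * (1 + N%:R * k) <= _).
    have : 0 <= N%:R * k * k by rewrite !mulr_ge0 // ltW.
    lra.
  by rewrite ler_wpM2l // addr_ge0 // ltW.
have rk0 : 0 < r * k by rewrite mulr_gt0.
have [N HN] : exists N : nat, pi / (r * k) < N%:R.
  by exists (Num.truncn (pi / (r * k))).+1; exact: truncnS_gt.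
have [n [w' /radpi]] := grow N; rewrite ltr_pdivrMr // in HN.
have : (1 + N%:R * k) * r <= (1 + k) ^+ N * r by rewrite ler_pM2r.
lra.
Qed.

End LogarithmicDiscs.

(** * The itinerary of excursions to the negative axis *)

Section Itinerary.
Context {R : realType} (a b A : R).

(* A state records bounds [lo, hi] for the reference orbits of all points of
   [a, b], the number of excursions so far, and whether the current point lies
   on the negative side. *)
Definition istate := (R * R * nat * bool)%type.

(** A switch to the negative side is decided by the lower bound one step earlier, so the points
    before and after the switch both lie above [A + j]. Since [j] grows, the excursions start ever
    farther out. *)
Definition inext (s : istate) : istate :=
  let: (lo, hi, j, p) := s in
  if p then (- expR hi, hi, j.+1, false)
  else (lo + 1, hi + 1 + expR hi, j, A + j%:R <= lo).

Definition istep i : istate := iter i inext (a, b, 0%N, false).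
Definition iside i : bool := (istep i).2.
Definition icount i : nat := (istep i).1.2.
Definition ilo i : R := (istep i).1.1.1.
Definition ihi i : R := (istep i).1.1.2.

End Itinerary.

(** * Real reference orbits *)

Section ReferenceOrbit.
Context {R : realType}.
Implicit Types (p : nat -> bool) (t : R).

(** The logarithm of the modulus along a real pseudo-orbit of [zexp] whose sign at time [i] is
    prescribed: negative when [p i] holds. *)
Fixpoint rorbit p i t : R :=
  if i is i'.+1 then
    rorbit p i' t + 1 + (-1) ^+ p i' * expR (rorbit p i' t)
  else t.

Lemma rorbit_side_le0 p i t : p i -> rorbit p i.+1 t <= 0.
Proof.
move=> pi /=; rewrite pi expr1 mulN1r subr_le0 addrC.
exact: expR_ge1Dx.
Qed.

Lemma continuous_rorbit p i : continuous (rorbit p i).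
Proof.
elim: i => [|i IH] t /=; first exact: cvg_id.
apply: cvgD; first by apply: cvgD; [exact: IH|exact: cvg_cst].
apply: cvgM; first exact: cvg_cst.
by apply: continuous_comp; [exact: IH|exact: continuous_expR].
Qed.

(** The itinerary is computed from bounds valid on all of [a, b], so one [p] serves every [t]. *)
Lemma itinerary (a b A : R) : 0 <= A ->
  exists p : nat -> bool,
  [/\ p 0%N = false,
      forall i t, a <= t <= b -> p i || p i.+1 -> A <= rorbit p i t,
      forall N, exists2 i, (N <= i)%N & p i
    & forall M : R, exists i, forall t, a <= t <= b -> M <= rorbit p i t].
Proof.
move=> A0; exists (iside a b A).
have nextE i : istep a b A i.+1 = inext A (istep a b A i) by [].
have inv i t : a <= t <= b ->
    ilo a b A i <= rorbit (iside a b A) i t <= ihi a b A i /\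
    (iside a b A i -> A + (icount a b A i)%:R <= ilo a b A i).
  move=> tab; elim: i => [|i []]; first by split.
  rewrite /ilo /ihi /icount /iside nextE /= -/(iside a b A i).
  have : iside a b A i = (istep a b A i).2 by [].
  case: (istep a b A i) => [[[lo hi] j] p] /= ->.
  set x := rorbit _ i t; have e0 := expR_gt0 x; have e1 := expR_ge1Dx x.
  have j0 : 0 <= j%:R :> R by [].
  case: p => /= /andP[lox xhi] H.
    have Alo := H isT; split => //.
    rewrite expr1 mulN1r.
    have : expR x <= expR hi by rewrite ler_expR.
    lra.
  split; last by move=> ?; lra.
  rewrite expr0 mul1r.
  have : expR x <= expR hi by rewrite ler_expR.
  lra.
have side1 i : iside a b A i.+1 ->
    iside a b A i = false /\ A + (icount a b A i)%:R <= ilo a b A i.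
  rewrite /ilo /icount /iside nextE.
  by case: (istep a b A i) => [[[lo hi] j] [|]] /=.
(* [n] bounds the rest of the way to the threshold, and on the positive side [lo] rises by 1 per
   step. *)
have reach n i J : iside a b A i = false -> icount a b A i = J ->
    A + J%:R - ilo a b A i <= n%:R ->
    exists i', iside a b A i' /\ icount a b A i' = J.
  elim: n i => [|n IH] i pi ci H.
    exists i.+1; move: pi ci H; rewrite /ilo /icount /iside nextE.
    case: (istep a b A i) => [[[lo hi] j] p] /= -> ->; rewrite subr_le0 => ->.
    by [].
  have [Hlo|Hlo] := boolP (A + J%:R <= ilo a b A i).
    exists i.+1; move: pi ci Hlo; rewrite /ilo /icount /iside nextE.
    by case: (istep a b A i) => [[[lo hi] j] p] /= -> -> ->.
  have := IH i.+1; move: pi ci H Hlo; rewrite /ilo /icount /iside nextE.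
  case: (istep a b A i) => [[[lo hi] j] p] /= -> -> H /negbTE ->.
  by apply => //; move: H; rewrite -(natr1 n) /=; lra.
have visit J : exists i, iside a b A i /\ icount a b A i = J.
  elim: J => [|J [i [pi ci]]].
    have [n Hn] : exists n : nat, A + 0%:R - a < n%:R.
      by exists (Num.truncn (A + 0%:R - a)).+1; exact: truncnS_gt.
    exact: (reach n 0%N 0%N erefl erefl (ltW Hn)).
  have [n Hn] : exists n : nat, A + J.+1%:R - ilo a b A i.+1 < n%:R.
    by exists (Num.truncn (A + J.+1%:R - ilo a b A i.+1)).+1; exact: truncnS_gt.
  apply: (reach n i.+1 J.+1 _ _ (ltW Hn)).
    move: pi ci; rewrite /icount /iside nextE.
    by case: (istep a b A i) => [[[lo hi] j] p] /= ->.
  move: pi ci; rewrite /icount /iside nextE.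
  by case: (istep a b A i) => [[[lo hi] j] p] /= -> ->.
(* The visit with count [J] therefore happens at a time at least [J], so excursions occur
   arbitrarily late. *)
have cle i : (icount a b A i <= i)%N.
  elim: i => // i; rewrite /icount nextE.
  by case: (istep a b A i) => [[[lo hi] j] [|]] //= /leqW.
split=> //.
- move=> i t tab /orP[pi|/side1[_ H]].
    have [/andP[H1 _] /(_ pi) H2] := inv i t tab.
    have : 0 <= (icount a b A i)%:R :> R by [].
    lra.
  have [/andP[H1 _] _] := inv i t tab.
  have : 0 <= (icount a b A i)%:R :> R by [].
  lra.
- by move=> N; have [i [pi ci]] := visit N; exists i => //; rewrite -ci cle.
move=> M; have [J HJ] : exists J : nat, M < J%:R.
  by exists (Num.truncn M).+1; exact: truncnS_gt.
have [i [pi ci]] := visit J; exists i => t tab.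
have [/andP[H1 _] /(_ pi)] := inv i t tab; rewrite ci; lra.
Qed.

End ReferenceOrbit.

(** * Shadowing of the reference orbits *)

Section Shadowing.
Context {R : realType}.
Implicit Types (w v z h : R[i]) (x t : R) (p : nat -> bool).

Lemma Re_cexp_near v x (d : R) : d <= 1 / 4 -> nm (v - x%:C%C) <= d ->
  expR x / 2 <= Re (cexp v).
Proof.
move=> d4 vx; set h := v - x%:C%C in vx.
have -> : v = x%:C%C + h by rewrite /h addrC subrK.
rewrite cexpD cexp_real Re_realM ler_pM2l ?expR_gt0 //.
have h4 : nm h <= 1 / 4 := le_trans vx d4.
have : nm (cexp h - 1) <= 1 / 2.
  apply: le_trans (nm_cexpB1 _) _.
  apply: le_trans (_ : 1 / 4 * 2 <= _); last lra.
  by rewrite ler_pM ?nm_ge0 ?expR_ge0 // expR_half_le2 //; lra.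
have := Re_le_nm (cexp h - 1); rewrite ReD ReN ler_norml.
have -> : Re (1 : R[i]) = 1 by [].
lra.
Qed.

(** The derivative is integrated along the segment, which stays in the convex disc. Unlike a bound
    on the modulus, the real part survives the addition of [v - v'] in [flog]. *)
Lemma cexp_expanding v v' x (d : R) : d <= 1 / 4 -> nm (v - x%:C%C) <= d ->
  nm (v' - x%:C%C) <= d ->
  expR x / 2 * nm (v - v') ^+ 2 <= Re ((v - v')^*%C * (cexp v - cexp v')).
Proof.
move=> d4 vx v'x; set h := v - v'; set m := expR x / 2.
have E (s : R) := is_derive_cexp_ray (h^*)%C v' h s.
have D (s : R) : is_derive s 1
   (fun s => Re (h^*%C * cexp (v' + s%:C%C * h)) - s * (m * nm h ^+ 2))
   (Re (h^*%C * (h * cexp (v' + s%:C%C * h))) - m * nm h ^+ 2).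
  by have Es := E s; der; rewrite /=; ring.
have := MVT_le D; rewrite !(mul0r, mul1r, addr0, subr0).
have -> : v' + h = v by rewrite /h addrC subrK.
rewrite mulrBr ReD ReN => H; rewrite lerBrDl -lerBrDr; apply: H => s /andP[s0 s1].
rewrite subr_ge0 mulrA (_ : h^*%C * h = (nm h ^+ 2)%:C%C); last first.
  by rewrite nm_sq; case: (h) => c e; apply: ReIm_eq; rewrite !ReImE /=; ring.
rewrite Re_realM mulrC ler_wpM2l ?sqr_ge0 //; apply: (Re_cexp_near d4).
have -> : v' + s%:C%C * h - x%:C%C =
    (1 - s)%:C%C * (v' - x%:C%C) + s%:C%C * (v - x%:C%C).
  by rewrite rmorphB /= /h; ring.
apply: le_trans (nmD _ _) _; rewrite !nmM !nm_real !ger0_norm ?subr_ge0 //.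
have : (1 - s) * nm (v' - x%:C%C) <= (1 - s) * d by rewrite ler_wpM2l // subr_ge0.
have : s * nm (v - x%:C%C) <= s * d by rewrite ler_wpM2l.
lra.
Qed.

(* The exponential of this point is [(-1) ^ (p i)] times a positive real. *)
Definition pseudo p i t : R[i] :=
  ((rorbit p i t)%:C + (if p i then pi else 0) *i)%C.

Lemma cexp_side (q : bool) w :
  cexp (w + ((if q then pi else 0) *i)%C) = (-1) ^+ q * cexp w.
Proof.
rewrite cexpD mulrC; case: q; first by rewrite cexp_pi.
by rewrite -[(0 *i)%C]/(0 : R[i]) cexp0 expr0.
Qed.

(** The reference points are an orbit of the lift up to a vertical jump of [pi] at each change of
    side. *)
Lemma flog_pseudo p i t :
  flog (pseudo p i t) = pseudo p i.+1 t +
   (((if p i then pi else 0) - (if p i.+1 then pi else 0)) *i)%C.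
Proof.
rewrite /flog cexp_side cexp_real /pseudo.
by apply: ReIm_eq; rewrite !ReImE /=; case: (p i); case: (p i.+1);
  rewrite ?expr0 ?expr1 /=; ring.
Qed.

Definition shadows p t (d : R) w :=
  forall i, nm (iter i flog w - pseudo p i t) <= d.

Section Orbit.
Context (p : nat -> bool) (a b d L : R).
Hypothesis d0 : 0 < d.
Hypothesis d4 : d <= 1 / 4.
Hypothesis L2 : 2 <= L.
Hypothesis Ld : d + pi <= L * d.
Hypothesis big : forall i t, a <= t <= b -> p i || p i.+1 ->
  2 * L + 2 <= expR (rorbit p i t).

Lemma pseudo_near i t w :
  nm (w - pseudo p i t) <= d ->
  nm ((w - ((if p i then pi else 0) *i)%C) - (rorbit p i t)%:C%C) <= d.
Proof. by rewrite /pseudo opprD addrA addrAC. Qed.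

Lemma nm_dflog i t w : a <= t <= b -> nm (w - pseudo p i t) <= d ->
  (if p i || p i.+1 then L else 1) <= nm (1 + cexp w).
Proof.
move=> tab /pseudo_near; set v := w - _ => vx.
have -> : w = v + ((if p i then pi else 0) *i)%C by rewrite /v subrK.
have H := Re_cexp_near d4 vx; rewrite cexp_side.
have e0 := expR_gt0 (rorbit p i t).
have [/(big tab) B|] := boolP (p i || p i.+1).
  have := nm_geB ((-1) ^+ p i * cexp v) 1.
  rewrite (addrC _ 1) nm1 nmM.
  have -> : nm ((-1) ^+ p i : R[i]) = 1.
    by case: (p i); rewrite ?expr0 ?expr1 ?nmN nm1.
  have := Re_le_nm (cexp v); rewrite ler_norml mul1r; lra.
rewrite negb_or => /andP[/negbTE -> _]; rewrite expr0 mul1r.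
have := Re_le_nm (1 + cexp v); rewrite ReD ler_norml.
have -> : Re (1 : R[i]) = 1 by [].
lra.
Qed.

(** At a change of side the derivative is at least [L], and [L d >= d + pi] absorbs the jump;
    elsewhere there is no jump and a derivative of at least 1 suffices for [covering]. *)
Lemma pull_back i t w' : a <= t <= b -> nm (w' - pseudo p i.+1 t) < d ->
  exists2 w, nm (w - pseudo p i t) < d & flog w = w'.
Proof.
move=> tab w'd; set m : R := if p i || p i.+1 then L else 1.
have L20 := L2.
have m0 : 0 < m by rewrite /m; case: ifP => _ //; lra.
apply: (@covering _ flog _ _ m) => //.
  move=> w wd; exists (1 + cexp w); first exact: cdiff_flog.
  by apply: nm_dflog tab _; apply: ltW.
rewrite flog_pseudo opprD addrA; apply: le_lt_trans (nmB_le _ _) _.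
rewrite nm_i /m.
case: (p i); case: (p i.+1) => /=; rewrite ?subr0 ?sub0r ?subrr ?normrN ?normr0;
  rewrite ?(ger0_norm (pi_ge0 _)); have := pi_gt0 R; have := Ld; lra.
Qed.

Lemma finite_shadow n i t : a <= t <= b -> exists w,
  forall k, (k <= n)%N -> nm (iter k flog w - pseudo p (i + k) t) < d.
Proof.
move=> tab; elim: n i => [|n IH] i.
  exists (pseudo p i t) => k; rewrite leqn0 => /eqP ->.
  by rewrite addn0 subrr nm0.
have [w' Hw'] := IH i.+1.
have [|w wd ww'] := @pull_back i t w' tab.
  by have := Hw' 0%N isT; rewrite addn0.
exists w => -[_|k]; first by rewrite addn0.
by rewrite ltnS => /Hw'; rewrite addnS addSn iterSr ww'.
Qed.

Lemma iter_flog_ccont k w : ccont (iter k flog) w.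
Proof.
elim: k => [|k IH] /=.
  by move=> e e0; exists e.
apply: (@ccont_comp _ (iter k flog) flog) => //.
exact: cdiff_ccont (cdiff_flog _).
Qed.

(** An accumulation point of the starting points of ever longer finite shadows. *)
Lemma exists_shadow t : a <= t <= b -> exists w, shadows p t d w.
Proof.
move=> tab; have /choice[u Hu] : forall n, exists w, forall k, (k <= n)%N ->
    nm (iter k flog w - pseudo p k t) < d.
  by move=> n; have [w Hw] := finite_shadow n 0 tab; exists w => k /Hw.
have ub n : nm (u n) <= d + nm (pseudo p 0 t).
  by apply: nm_le_add; apply: ltW; exact: (Hu n 0%N isT).
have [w Hw] := bolzano_weierstrass ub.
exists w => k; apply/ler_addgt0Pr => /= e e0.
have [r r0 Hr] := iter_flog_ccont k w e0.
have [n kn /Hr H] := Hw _ r0 k.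
have := Hu n k kn; rewrite nmB_sym in H.
have := nm_le_dist (iter k flog w) (pseudo p k t) (iter k flog (u n)).
lra.
Qed.

(** On the positive side, the inner product of [h] with [h + D] is at least [nm h ^ 2]. On the
    negative side, [D] has modulus at least [3 nm h], of which [h] cancels at most one third. *)
Lemma flog_expanding i t w w' : a <= t <= b -> nm (w - pseudo p i t) <= d ->
  nm (w' - pseudo p i t) <= d ->
  (if p i then 2 else 1) * nm (w - w') <= nm (flog w - flog w').
Proof.
move=> tab /pseudo_near Hw /pseudo_near Hw'.
have := cexp_expanding d4 Hw Hw'.
set c := ((if p i then pi else 0) *i)%C; set v := w - c; set v' := w' - c.
have -> : v - v' = w - w' by rewrite /v /v'; ring.
set h := w - w'; set D := cexp v - cexp v' => H.
have [h0|h0] := eqVneq h 0; first by rewrite h0 nm0 mulr0 nm_ge0.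
have nh : 0 < nm h by rewrite nm_gt0.
have -> : flog w - flog w' = h + (-1) ^+ p i * D.
  have -> : w = v + c by rewrite /v subrK.
  have -> : w' = v' + c by rewrite /v' subrK.
  rewrite /flog !cexp_side /D.
  have -> : h = v - v' by rewrite /h /v /v'; ring.
  by ring.
have e0 := expR_gt0 (rorbit p i t).
case: ifP => pi_; last first.
  rewrite expr0 !mul1r -(ler_pM2l nh).
  have := Re_le_nm (h^*%C * (h + D)); rewrite ler_norml nmM nm_conj.
  have -> : Re (h^*%C * (h + D)) = nm h ^+ 2 + Re (h^*%C * D).
    by rewrite mulrDr ReD nm_sq; congr (_ + _); case: (h) => ? ? /=; ring.
  have : 0 <= expR (rorbit p i t) / 2 * nm h ^+ 2.
    by rewrite mulr_ge0 ?sqr_ge0 // divr_ge0 // ltW.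
  rewrite -expr2; lra.
have B := big (i := i) tab; rewrite pi_ in B; have {}B := B isT.
rewrite expr1 mulN1r.
have HD : 3 * nm h <= nm D.
  rewrite -(ler_pM2l nh).
  have := Re_le_nm (h^*%C * D); rewrite ler_norml nmM nm_conj => /andP[_ H2].
  apply: le_trans (le_trans H H2).
  rewrite (_ : nm h * (3 * nm h) = 3 * nm h ^+ 2); last by ring.
  rewrite ler_wpM2r ?sqr_ge0 //; have := L2; lra.
have := nm_geB (- D) h; rewrite nmN (addrC (- D)); lra.
Qed.

Hypothesis pinf : forall N, exists2 i, (N <= i)%N & p i.

(** The distance between the two orbits never decreases and at least doubles at each of the
    infinitely many times on the negative side, yet it is at most [2 d]. *)
Lemma shadow_unique t w w' : a <= t <= b ->
  shadows p t d w -> shadows p t d w' -> w = w'.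
Proof.
move=> tab sw sw'.
have grow i : nm (iter i flog w - iter i flog w') <=
    nm (iter i.+1 flog w - iter i.+1 flog w').
  have := flog_expanding tab (sw i) (sw' i).
  have := nm_ge0 (iter i flog w - iter i flog w'); rewrite !iterS.
  by case: ifP; lra.
have grow2 i k : nm (iter i flog w - iter i flog w') <=
    nm (iter (i + k) flog w - iter (i + k) flog w').
  elim: k => [|k IH]; first by rewrite addn0.
  by rewrite addnS (le_trans IH).
have pw M : exists i, 2 ^+ M * nm (w - w') <=
    nm (iter i flog w - iter i flog w').
  elim: M => [|M [i IH]]; first by exists 0%N; rewrite expr0 mul1r.
  have [k ik pk] := pinf i; exists k.+1.
  have := flog_expanding tab (sw k) (sw' k); rewrite pk -!iterS.
  have := grow2 i (k - i)%N; rewrite subnKC // exprS => H1 H2.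
  by rewrite -mulrA; lra.
apply/eqP; rewrite -subr_eq0 -nm_eq0; apply/eqP/le_anti.
rewrite nm_ge0 andbT leNgt; apply/negP => h0.
have [M HM] : exists M : nat, 2 * d / nm (w - w') < M%:R.
  by exists (Num.truncn (2 * d / nm (w - w'))).+1; exact: truncnS_gt.
have [i Hi] := pw M.
rewrite ltr_pdivrMr // in HM.
have M2 : M%:R <= 2 ^+ M :> R.
  by rewrite -natrX ler_nat ltnW // ltn_expl.
have : M%:R * nm (w - w') <= 2 ^+ M * nm (w - w') by rewrite ler_pM2r.
have := nm_le_dist (iter i flog w) (iter i flog w') (pseudo p i t).
have := sw i; have := sw' i; rewrite (nmB_sym (pseudo p i t)); lra.
Qed.

(** Uniqueness gives continuity: by compactness, a jump at [t] would produce a second point that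
    shadows the orbit of [t]. *)
Lemma shadow_curve : exists g : R -> R[i],
  (forall t, a <= t <= b -> shadows p t d (g t)) /\
  (forall t, a <= t <= b -> forall e : R, 0 < e -> exists2 r : R, 0 < r &
     forall s, a <= s <= b -> `|s - t| < r -> nm (g s - g t) < e).
Proof.
have /choice[g Hg] : forall t : R, exists w, a <= t <= b -> shadows p t d w.
  move=> t; have [tab|] := boolP (a <= t <= b); last by exists 0.
  by have [w Hw] := exists_shadow tab; exists w.
exists g; split=> // t tab e e0; apply: contrapT => no.
have /choice[s Hs] : forall n : nat, exists s : R,
    [/\ a <= s <= b, `|s - t| < n.+1%:R^-1 & e <= nm (g s - g t)].
  move=> n; apply: contrapT => non; apply: no.
  exists n.+1%:R^-1 => [|s sab st]; first by rewrite invr_gt0.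
  by rewrite ltNge; apply/negP => H; apply: non; exists s.
have gb n : nm (g (s n)) <= d + (`|a| + `|b| + nm (pseudo p 0 0)).
  have [sab _ _] := Hs n; apply: le_trans (nm_le_add (Hg _ sab 0%N)) _.
  rewrite lerD2l (_ : pseudo p 0 (s n) = (s n)%:C%C + pseudo p 0 0); last first.
    by rewrite /pseudo /=; apply: ReIm_eq; rewrite !ReImE /=; ring.
  apply: le_trans (nmD _ _) _; rewrite lerD2r nm_real.
  have := ler_norm b; have := ler_norm (- a); rewrite normrN.
  by have := normr_ge0 a; have := normr_ge0 b; rewrite ler_norml; lra.
have [w Hw] := bolzano_weierstrass gb.
have inv_small (r : R) : 0 < r -> exists N : nat, forall n, (N <= n)%N -> n.+1%:R^-1 < r.
  move=> r0; exists (Num.truncn r^-1) => n Nn.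
  rewrite -[r]invrK ltf_pV2 ?posrE ?invr_gt0 //.
  by rewrite (lt_le_trans (truncnS_gt _)) // ler_nat.
(* Shadowing passes to the limit since each iterate of [flog] and each [rorbit p k] is
   continuous. *)
have sw : shadows p t d w.
  move=> k; apply/ler_addgt0Pr => /= c c0; have c20 : 0 < c / 2 by rewrite divr_gt0.
  have [r r0 Hr] := iter_flog_ccont k w c20.
  have := @continuous_rorbit R p k t; move/cvgrPdist_lt => /(_ _ c20).
  move=> /nbhs_ballP[q /= q0 Hq].
  have [N HN] := inv_small _ q0.
  have [n Nn /Hr H] := Hw _ r0 N.
  have [sab st _] := Hs n.
  have := Hq (s n); rewrite -ball_normE /= distrC => /(_ (lt_trans st (HN _ Nn))) H2.
  have H3 := Hg _ sab k.
  have H4 : nm (pseudo p k (s n) - pseudo p k t) < c / 2.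
    rewrite (_ : _ - _ = (rorbit p k (s n) - rorbit p k t)%:C%C).
      by rewrite nm_real distrC.
    by rewrite /pseudo; apply: ReIm_eq; rewrite !ReImE /=; ring.
  have := nm_le_dist (iter k flog w) (pseudo p k t) (iter k flog (g (s n))).
  have := nm_le_dist (iter k flog (g (s n))) (pseudo p k t) (pseudo p k (s n)).
  rewrite nmB_sym in H; lra.
have wg := shadow_unique tab sw (Hg _ tab).
have e20 : 0 < e / 2 by rewrite divr_gt0.
have [n _ H] := Hw _ e20 0%N; have [_ _] := Hs n; rewrite -wg; lra.
Qed.

End Orbit.

End Shadowing.

(** * The three invariant sets and their connectedness *)

Section InvariantSets.
Context {R : realType}.
Implicit Types (z w : R[i]) (U V : set R[i]).

Local Notation I := (escaping_set (@zexp R)).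
Local Notation BO := (bounded_orbit_set (@zexp R)).
Local Notation BU := (bungee_set (@zexp R)).

Lemma escaping_zexp z : I (zexp z) <-> I z.
Proof.
split=> H M; have [N HN] := H M.
  by exists N.+1 => -[|n] // Nn; rewrite iterSr; apply: HN.
by exists N => n Nn; rewrite -iterSr; apply: HN; apply: leqW.
Qed.

Lemma bounded_orbitP z : BO z <-> exists K : R, forall n, nm (iter n zexp z) <= K.
Proof.
split=> [[K [_ HK]]|[K HK]].
  by exists K => n; have := HK n; rewrite normE ltcR => /ltW.
exists (K + 1); split.
  by have := HK 0%N; have := nm_ge0 (iter 0 zexp z); lra.
by move=> n; rewrite normE ltcR; have := HK n; lra.
Qed.

Lemma bounded_orbit_zexp z : BO (zexp z) <-> BO z.
Proof.
rewrite !bounded_orbitP; split=> -[K HK]; last first.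
  by exists K => n; rewrite -iterSr.
exists (Num.max K (nm z)) => -[|n]; first by rewrite le_max lexx orbT.
by rewrite iterSr le_max HK.
Qed.

Lemma bungee_back z : BU (zexp z) -> BU z.
Proof.
by move=> H [/escaping_zexp|/bounded_orbit_zexp] Hz; apply: H; [left|right].
Qed.

Lemma bounded_orbit_iter n z : BO (iter n zexp z) -> BO z.
Proof. by elim: n => // n IH; rewrite iterS => /bounded_orbit_zexp. Qed.

Lemma disc_bounded_orbit z : nm (1 + z) < 1 -> BO z.
Proof.
move=> z1; apply/bounded_orbitP; exists 2 => n.
have : nm (1 + iter n zexp z) < 1.
  by elim: n => // n IH; rewrite iterS; apply: zexp_disc.
have := nm_geB (iter n zexp z) 1; rewrite nm1 (addrC _ 1); lra.
Qed.

Lemma unbounded_orbit_out z : ~ BO z -> forall n, 1 <= nm (1 + iter n zexp z).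
Proof.
move=> nz n; rewrite leNgt; apply/negP => /disc_bounded_orbit.
by move/bounded_orbit_iter.
Qed.

Lemma unbounded_orbit z : ~ BO z -> forall M : R, exists n, M < nm (iter n zexp z).
Proof.
move=> nz M; apply: contrapT => no; apply: nz; apply/bounded_orbitP.
by exists M => n; rewrite leNgt; apply/negP => H; apply: no; exists n.
Qed.

Lemma escaping_unbounded z : I z -> ~ BO z.
Proof.
move=> Iz /bounded_orbitP[K HK]; have [N /(_ N (leqnn N))] := Iz K.
by rewrite normE ltcR ltNge HK.
Qed.

Lemma zexp_real (x : R) : zexp x%:C%C = (x * expR (x + 1))%:C%C.
Proof.
rewrite /zexp rmorphM /= -cexp_real; congr (_ * cexp _).
by rewrite rmorphD.
Qed.

Lemma positive_escaping (x : R) : 0 < x -> I x%:C%C.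
Proof.
move=> x0 M.
have H n : exists2 y : R, n%:R * x <= y /\ x <= y & iter n zexp x%:C%C = y%:C%C.
  elim: n => [|n [y [H1 H2] IH]]; first by exists x => //; rewrite mul0r ltW.
  exists (y * expR (y + 1)); last by rewrite iterS IH zexp_real.
  have y0 : 0 < y by apply: lt_le_trans H2.
  have : y * 2 <= y * expR (y + 1).
    by rewrite ler_pM2l //; have := expR_ge1Dx (y + 1); lra.
  rewrite -(natr1 n); lra.
have [N HN] : exists N : nat, M / x < N%:R.
  by exists (Num.truncn (M / x)).+1; exact: truncnS_gt.
exists N => n Nn; have [y [H1 H2] ->] := H n.
have y0 : 0 < y by apply: lt_le_trans H2.
rewrite normE ltcR nm_real gtr0_norm //; apply: lt_le_trans H1.
by rewrite -ltr_pdivrMr // (lt_le_trans HN) // ler_nat.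
Qed.

(** The inequality [y e^(1-y) <= 1] puts every later point into [-1, 0). *)
Lemma negative_bounded_orbit (x : R) : 0 < x -> BO (- x)%:C%C.
Proof.
move=> x0; apply/bounded_orbitP; exists (Num.max x 1) => n.
suff [y /andP[y0 y1] ->] : exists2 y : R, 0 < y <= Num.max x 1 &
    iter n zexp (- x)%:C%C = (- y)%:C%C.
  by rewrite nm_real normrN gtr0_norm.
elim: n => [|n [y /andP[y0 y1] IH]]; first by exists x; rewrite // x0 le_max lexx.
exists (y * expR (1 - y)); last by rewrite iterS IH zexp_real mulNr (addrC (- y)).
rewrite mulr_gt0 ?expR_gt0 //= le_max; apply/orP; right.
have -> : 1 - y = - (y - 1) by ring.
rewrite expRN ler_pdivrMr ?expR_gt0 // mul1r.
by have := expR_ge1Dx (y - 1); lra.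
Qed.

(** Some bounded image of an isolating set would contain a point of the positive axis and then, by
    [isolating_curve], points of it beyond any bound. *)
Lemma connected_escaping : connected (add_infty I).
Proof.
apply: connected_add_infty => U oU iU z Uz Iz.
have nz := escaping_unbounded Iz.
have [n [x x0 Vx]] :=
  blowup_positive oU Uz (unbounded_orbit_out nz) (unbounded_orbit nz).
have iV := isolating_iter n (fun z => (escaping_zexp z).1) iU.
have [_ [M HM] _] := iV.
pose b := x + `|M| + 1.
have : (iter n zexp @` U) b%:C%C.
  apply: (isolating_curve (tau := fun t => t%:C%C) iV (a := x)) => //.
  - by rewrite /b -addrA lerDl addr_ge0.
  - move=> t /andP[xt _]; have t0 : 0 < t by apply: lt_le_trans xt.
    split; first exact: positive_escaping.
    by apply/eqP => -[]; lra.
  - move=> t _ e e0; exists e => // s _ st.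
    by rewrite -rmorphB nm_real.
move/HM; rewrite nm_real; have := ler_norm M; have := ler_norm b; rewrite /b.
lra.
Qed.

(** Starting at [x > 1] keeps the ray to the left of the critical point. *)
Lemma isolating_ray V (x : R) : isolating BO V -> 1 < x -> V (- x)%:C%C -> False.
Proof.
move=> iV x1 Vx; have [_ [M HM] _] := iV; pose b := x + `|M| + 1.
have : V (- b)%:C%C.
  apply: (isolating_curve (tau := fun t => (- t)%:C%C) iV (a := x)) => //.
  - by rewrite /b -addrA lerDl addr_ge0.
  - move=> t /andP[xt _]; have t1 : 1 < t by apply: lt_le_trans xt.
    split; first by apply: negative_bounded_orbit; apply: lt_trans t1.
    by apply/eqP => -[]; lra.
  - move=> t _ e e0; exists e => // s _ st.
    by rewrite -rmorphB nm_real -opprD normrN.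
move/HM; rewrite nm_real normrN.
have := ler_norm M; have := ler_norm b; rewrite /b; lra.
Qed.

(** The circle about [-1] through [p] lies in [D] and leads to a real point left of [-1], where a
    ray of the negative axis takes over. *)
Lemma isolating_disc V p : isolating BO V -> V p -> nm (1 + p) < 1 -> p != -1 ->
  False.
Proof.
move=> iV Vp p1 pn1.
have u0 : 1 + p != 0 by rewrite addrC addr_eq0.
have [w wp w1] := cexp_log u0.
have ew : expR (Re w) < 1 by rewrite -nm_cexp wp.
pose tau t : R[i] := -1 + cexp (Re w +i* t)%C.
have tau1 t : 1 + tau t = cexp (Re w +i* t)%C by rewrite /tau addrA subrr add0r.
have nt t : nm (1 + tau t) = expR (Re w) by rewrite tau1 nm_cexp.
have : V (tau pi).
  apply: (isolating_curve (tau := tau) iV (a := Im w)).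
  - by apply: le_trans (ler_norm _) w1.
  - move=> t _; split; first by apply: disc_bounded_orbit; rewrite nt.
    by rewrite -addr_eq0 addrC -nm_eq0 nt gt_eqF // expR_gt0.
  - move=> t _ e e0.
    have [d d0 Hd] := cdiff_ccont (cdiff_cexp (Re w +i* t)%C) e0.
    exists d => // s _ st.
    rewrite (_ : tau s - tau t = cexp (Re w +i* s)%C - cexp (Re w +i* t)%C);
      last by rewrite /tau; ring.
    apply: Hd; rewrite (_ : _ - _ = ((s - t) *i)%C) ?nm_i //.
    by apply: ReIm_eq; rewrite !ReImE /=; ring.
  - rewrite (_ : tau (Im w) = p) // /tau.
    have -> : (Re w +i* Im w)%C = w by case: (w).
    by rewrite wp; ring.
rewrite (_ : tau pi = (- (1 + expR (Re w)))%:C%C).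
  by apply: isolating_ray => //; rewrite ltrDl expR_gt0.
rewrite /tau; apply: ReIm_eq; rewrite !ReImE /= ?cospi ?sinpi; ring.
Qed.

(* [-1] is a fixed critical point, but it is reached only from itself or from a
   point where [zexp] is open. *)
Lemma iter_image_ballN1 A U n : (forall z, A (zexp z) -> A z) -> nm_open U ->
  isolating A U -> (iter n zexp @` U) (-1) ->
  exists m, exists2 r : R, 0 < r &
    forall y, nm (y - (-1)) < r -> (iter m zexp @` U) y.
Proof.
move=> bA oU iU; elim: n => [|n IH].
  move=> [u Uu /= u1]; rewrite u1 in Uu; have [r r0 Hr] := oU _ Uu.
  by exists 0%N; exists r => // y /Hr Uy; exists y.
rewrite image_iterS => -[u Vu fu].
have [u1|u1] := eqVneq u (-1); first by apply: IH; rewrite -u1.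
have [oV _ _] := isolating_iter n bA iU.
have [r r0 Hr] := oV _ Vu u1; have [s s0 Hs] := zexp_open u1 r0.
exists n.+1; exists s => // y; rewrite -fu => /Hs[v /Hr Vv <-].
by rewrite image_iterS; exists v.
Qed.

Lemma connected_bounded_orbit : connected (add_infty BO).
Proof.
apply: connected_add_infty => U oU iU z Uz _.
have bA z' : BO (zexp z') -> BO z' by move/bounded_orbit_zexp.
have [n [p [Vp Hp]]] := blowup_bounded oU Uz.
have iV m := isolating_iter m bA iU.
(* If the point found is [-1] itself, some image contains a neighbourhood of [-1], and a nearby
   point of [D] is used instead. *)
have [p1|p1] := eqVneq p (-1).
  rewrite p1 in Vp; have [m [r r0 Hr]] := iter_image_ballN1 bA oU iU Vp.
  pose s := Num.min (r / 2) (1 / 2).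
  have s0 : 0 < s by rewrite lt_min !divr_gt0.
  have sr : s <= r / 2 by rewrite ge_min lexx.
  have s1 : s <= 1 / 2 by rewrite ge_min lexx orbT.
  apply: (isolating_disc (iV m) (p := -1 + s%:C%C)).
  - by apply: Hr; rewrite addrC addKr nm_real gtr0_norm //; lra.
  - by rewrite addrA subrr add0r nm_real gtr0_norm //; lra.
  - by rewrite -subr_eq0 addrC addKr -nm_gt0 nm_real gtr0_norm.
case: Hp => [pd|[x x0 px]]; first exact: isolating_disc (iV n) Vp pd p1.
(* Points [-x] with [x < 2] lie in [D]; those further left start a ray. *)
have [x2|x2] := ltP x 2; last first.
  by rewrite px in Vp; apply: isolating_ray (iV n) _ Vp; lra.
apply: isolating_disc (iV n) Vp _ p1.
rewrite px (_ : 1 + _ = (1 - x)%:C%C); last by rewrite rmorphD /= rmorph1.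
by rewrite nm_real ltr_norml; lra.
Qed.

(** Right after each excursion the modulus is at most [e^d <= 2], so the orbit does not escape; it
    is unbounded because the reference orbit is unbounded above. *)
Lemma shadow_bungee (a b d : R) (p : nat -> bool) (t : R) w :
  a <= t <= b -> d <= 1 / 4 -> shadows p t d w ->
  (forall N, exists2 i, (N <= i)%N & p i) ->
  (forall M : R, exists i, forall t, a <= t <= b -> M <= rorbit p i t) ->
  BU (cexp w).
Proof.
move=> tab d4 sw pinf pbig.
have Rew i : `|Re (iter i flog w) - rorbit p i t| <= d.
  apply: le_trans (sw i); apply: le_trans (Re_le_nm _).
  by rewrite /pseudo !ReImE /= addr0.
have orb i : nm (iter i zexp (cexp w)) = expR (Re (iter i flog w)).
  by rewrite iter_zexp_cexp nm_cexp.
move=> [Iw|/bounded_orbitP[K HK]].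
  have [N HN] := Iw 2; have [i Ni pi_] := pinf N.
  have := HN i.+1 (leqW Ni); rewrite normE ltcR orb ltNge.
  rewrite expR_half_le2 //; have := rorbit_side_le0 t pi_.
  by have := Rew i.+1; rewrite ler_norml; lra.
have [i /(_ t tab) Hi] := pbig (K + 1).
have := HK i; rewrite orb; have := expR_ge1Dx (Re (iter i flog w)).
have := Rew i; rewrite ler_norml; lra.
Qed.

(** The positive axis escapes, so the unbounded curve is replaced by the exponential of a shadowing
    curve near it, which starts in [V] and ends beyond the bound [M]. *)
Lemma connected_bungee : connected (add_infty BU).
Proof.
apply: connected_add_infty => U oU iU z Uz BUz.
have nz : ~ BO z by move=> Bz; apply: BUz; right.
have [n [x x0 Vx]] :=
  blowup_positive oU Uz (unbounded_orbit_out nz) (unbounded_orbit nz).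
have := isolating_iter n bungee_back iU.
move: (iter n zexp @` U) Vx => V Vx iV; have [oV [M HM] _] := iV.
pose a := ln x; have xa : x = expR a by rewrite lnK.
have [|r r0 Hr] := oV _ Vx; first by apply/eqP => -[]; lra.
have [d0 d00 Hd0] := cdiff_ccont (cdiff_cexp a%:C%C) r0.
pose d := Num.min (1 / 4) (d0 / 2).
have dp : 0 < d by rewrite lt_min !divr_gt0.
have d4 : d <= 1 / 4 by rewrite ge_min lexx.
have dd0 : d <= d0 / 2 by rewrite ge_min lexx orbT.
(* Then [L d = 2 d + pi], which leaves room for the jump of [pi]. *)
pose L := 2 + pi / d; have pd : 0 < pi / d by rewrite divr_gt0 ?pi_gt0.
have L2 : 2 <= L by rewrite /L; lra.
have Ld : d + pi <= L * d by rewrite /L mulrDl divfK ?gt_eqF //; lra.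
(* As [d <= 1/4], a point within [d] of [b] has an exponential of modulus above [M]. *)
pose b := `|a| + `|M| + 1.
have ab : a <= b.
  by have := ler_norm a; have := normr_ge0 M; rewrite /b; lra.
have [|p [p0 pA pinf pbig]] := @itinerary R a b (2 * L + 2); first lra.
have big i t : a <= t <= b -> p i || p i.+1 -> 2 * L + 2 <= expR (rorbit p i t).
  move=> tab H; have := pA i t tab H; have := expR_ge1Dx (rorbit p i t); lra.
have [g [Hg cg]] := shadow_curve dp d4 L2 Ld big pinf.
have BUg t : a <= t <= b -> BU (cexp (g t)).
  by move=> tab; apply: (shadow_bungee tab d4 (Hg _ tab)).
have g0 t : a <= t <= b -> nm (g t - t%:C%C) <= d.
  move=> tab; have := Hg _ tab 0%N; rewrite /pseudo p0 /=.
  by rewrite (_ : t%:C%C + _ = t%:C%C) // -[(0 *i)%C]/(0 : R[i]) addr0.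
have : V (cexp (g b)).
  apply: (isolating_curve (tau := fun t => cexp (g t)) iV ab).
  - move=> t tab; split; first exact: BUg.
    apply/eqP => E; have := BUg _ tab; rewrite E; apply; right.
    by apply: disc_bounded_orbit; rewrite subrr nm0.
  - move=> t tab e e0.
    have [r1 r10 Hr1] := cdiff_ccont (cdiff_cexp (g t)) e0.
    have [r2 r20 Hr2] := cg _ tab _ r10.
    by exists r2 => // s sab st; apply: Hr1; apply: Hr2.
  apply: Hr; rewrite xa -cexp_real; apply: Hd0.
  by apply: le_lt_trans (g0 a _) _; [rewrite lexx|lra].
move/HM; rewrite nm_cexp.
have := g0 b; rewrite ab lexx => /(_ isT) gb.
have := le_trans (Re_le_nm _) gb; rewrite !ReImE /= ler_norml.
have := expR_ge1Dx (Re (g b)); have := ler_norm M; have := normr_ge0 a.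
rewrite /b; lra.
Qed.

End InvariantSets.

Theorem theorem1p1 (R : realType) :
  exists f : R[i] -> R[i],
    entire f /\ transcendental f /\
    connected (add_infty (escaping_set f)) /\
    connected (add_infty (bounded_orbit_set f)) /\
    connected (add_infty (bungee_set f)).
Proof.
exists zexp; split; first exact: zexp_entire.
split; first exact: zexp_transcendental.
split; first exact: connected_escaping.
by split; [exact: connected_bounded_orbit|exact: connected_bungee].
Qed.
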